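(* For each $n\in\mathbb Z_{>1}$ and $0\le j\le n$: (1) $w_{n,j}:=Q^j\varphi^+(-n)\cdots\varphi^+(-1){\bf 1}$ is a singular vector in $\overline F$ (for the Virasoro algebra spanned by the $L(m)$). (2) $Q^n\varphi^+(-n)\cdots\varphi^+(-1){\bf 1}=\nu\,\varphi^-(-n)\cdots\varphi^-(-1){\bf 1}$ for a certain $\nu\ne0$. As an $L^{Vir}(-2,0)$-module, $$\overline F=\bigoplus_{n=0}^\infty(n+1)\,L^{Vir}\big(-2,\tfrac{n^2+n}2\big).$$
   Context: Everything is over $\mathbb C$. $F$ is the Clifford vertex superalgebra generated by odd fields $\Phi_i(z)=\sum_{r\in\frac12+\mathbb Z}\Phi_i(r)z^{-r-1/2}$, $i=1,2$, with $[\Phi_i(r),\Phi_j(s)]_+=\delta_{r+s,0}\delta_{i,j}$; $\overline F=\mathrm{Ker}_F\Phi_2(\tfrac12)=\bigwedge(\Phi_1(-r+\tfrac12),\Phi_2(-r-\tfrac12)\mid r\in\mathbb Z_{>0})$. $D$ is the canonical derivation; $\Psi^{\pm}=\frac1{\sqrt2}(\Phi_1\pm\sqrt{-1}\,\Phi_2)$. The vector $\omega=\sqrt{-1}\,\Phi_2(-\tfrac32)\Phi_1(-\tfrac12){\bf 1}+\Phi_1(-\tfrac32)\Phi_1(-\tfrac12){\bf 1}\in\overline F$ is a Virasoro vector of central charge $-2$; $L(n)=\omega_{n+1}$ and $\overline F$ is regarded as a Virasoro module via the $L(n)$. $Q=L(-1)-D=(D\Psi^+\Psi^+)_0$, where $D\Psi^+\Psi^+=\Psi^+(-\tfrac32)\Psi^+(-\tfrac12){\bf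 1}$. The operators on $\overline F$: $\varphi^-(n)=-\frac n{\sqrt2}(\Phi_1(n-\tfrac12)+\sqrt{-1}\Phi_2(n-\tfrac12))$, $\varphi^+(n)=-\sqrt2(n\Phi_1(n+\tfrac12)+\sqrt{-1}(n+1)\Phi_2(n+\tfrac12))$. $L^{Vir}(c,h)$ is the irreducible highest weight Virasoro module of central charge $c$ and highest weight $h$; $L^{Vir}(c,0)$ also denotes the simple Virasoro vertex algebra; $(n+1)M$ means the direct sum of $n+1$ copies of $M$. A singular vector is an $L(0)$-eigenvector annihilated by $L(m)$, $m\ge1$. *)

(* Defs.v *)
From HB Require Import structures.
From mathcomp Require Import all_boot all_order all_algebra.
From mathcomp Require Import complex reals.

Set Implicit Arguments.
Unset Strict Implicit.
Unset Printing Implicit Defensive.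

Import Order.TTheory GRing.Theory Num.Theory.
Local Open Scope ring_scope.

Definition subspace (C : nzRingType) (V : lmodType C) (U : V -> Prop) : Prop :=
  U 0 /\ forall (a : C) (u v : V), U u -> U v -> U (a *: u + v).

(* M n j, for j <= n, is a family of n + 1 subspaces for every n; U is their
   internal direct sum. *)
Definition internal_direct_sum (C : nzRingType) (V : lmodType C)
    (U : V -> Prop) (M : nat -> nat -> V -> Prop) : Prop :=
  [/\ (forall n j : nat, (j <= n)%N ->
         subspace (M n j) /\ forall v, M n j v -> U v),
      (forall v, U v -> exists (N : nat) (f : nat -> nat -> V),
         (forall n j : nat, (j <= n)%N -> M n j (f n j)) /\
         v = \sum_(n < N) \sum_(j < n.+1) f n j)
    & (forall (N : nat) (f : nat -> nat -> V),
         (forall n j : nat, (j <= n)%N -> M n j (f n j)) ->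
         \sum_(n < N) \sum_(j < n.+1) f n j = 0 ->
         forall n j : nat, (n < N)%N -> (j <= n)%N -> f n j = 0)].

(* The generalized binomial coefficient m (m - 1) ... (m - j + 1) / j!. *)
Definition gbin (C : fieldType) (m : int) (j : nat) : C :=
  (\prod_(i < j) (m - i%:Z)%:~R) / (j`!)%:R.

(* [nprod a n b] is the n-th product a_(n) b, i.e. Y(a, z) b is the sum of
   (a_(n) b) z^(-n-1).  The two infinite sums of the Borcherds identity have
   finitely many nonzero terms, so the identity is required for all
   sufficiently long partial sums. *)
Record vertexSuperalgebra (C : fieldType) := VertexSuperalgebra {
  va_sort :> lmodType C;
  va_par : bool -> va_sort -> Prop;
  vac : va_sort;
  nprod : va_sort -> int -> va_sort -> va_sort;
  va_par_subspace : forall p, subspace (va_par p);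
  va_par_sum : forall v, exists u w,
    [/\ va_par false u, va_par true w & v = u + w];
  va_par_cap : forall v, va_par false v -> va_par true v -> v = 0;
  nprod_linear_r : forall a n, linear (nprod a n);
  nprod_linear_l : forall n b, linear (fun a => nprod a n b);
  nprod_par : forall p q a b n,
    va_par p a -> va_par q b -> va_par (p (+) q) (nprod a n b);
  nprod_truncation : forall a b,
    exists N : int, forall n : int, N <= n -> nprod a n b = 0;
  vac_even : va_par false vac;
  nprod_vacl : forall (n : int) b, nprod vac n b = if n == -1 then b else 0;
  nprod_vacr : forall (n : int) a, 0 <= n -> nprod a n vac = 0;
  nprod_creation : forall a, nprod a (-1) vac = a;
  borcherds : forall (p q : bool) (a b c : va_sort) (m n k : int),
    va_par p a -> va_par q b ->
    exists N0 : nat, forall N : nat, (N0 <= N)%N ->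
      \sum_(j < N) gbin C m j *:
         nprod (nprod a (n + j%:Z) b) (m + k - j%:Z) c
      = \sum_(j < N) ((-1) ^+ j * gbin C n j) *:
         (nprod a (m + n - j%:Z) (nprod b (k + j%:Z) c)
          - ((-1) ^+ (p && q) * (-1) ^ n) *:
            nprod b (n + k - j%:Z) (nprod a (m + j%:Z) c))
}.

(* The canonical derivation. *)
Definition vaD (C : fieldType) (V : vertexSuperalgebra C) (a : V) : V :=
  nprod a (-2) (vac V).

(* The vertex subalgebra generated by S. *)
Inductive va_gen (C : fieldType) (V : vertexSuperalgebra C) (S : V -> Prop) :
    V -> Prop :=
  | VaGenIn v : S v -> va_gen S v
  | VaGenVac : va_gen S (vac V)
  | VaGen0 : va_gen S 0
  | VaGenLin (a : C) u v : va_gen S u -> va_gen S v -> va_gen S (a *: u + v)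
  | VaGenProd u n v : va_gen S u -> va_gen S v -> va_gen S (nprod u n v).

Definition va_stable (C : fieldType) (V : vertexSuperalgebra C)
    (U M : V -> Prop) : Prop :=
  forall u (n : int) v, U u -> M v -> M (nprod u n v).

Definition va_ideal (C : fieldType) (V : vertexSuperalgebra C)
    (U I : V -> Prop) : Prop :=
  [/\ subspace I, (forall v, I v -> U v), va_stable U I
    & forall v (n : int) u, I v -> U u -> I (nprod v n u)].

Definition va_simple (C : fieldType) (V : vertexSuperalgebra C)
    (U : V -> Prop) : Prop :=
  (exists2 v, U v & v <> 0) /\
  forall I, va_ideal U I ->
    (forall v, I v -> v = 0) \/ (forall v, U v -> I v).

Definition virasoro_module (C : fieldType) (V : lmodType C)
    (L : int -> V -> V) (M : V -> Prop) (c : C) : Prop :=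
  [/\ subspace M, (forall n, linear (L n)), (forall n v, M v -> M (L n v))
    & forall (m n : int) v, M v ->
        L m (L n v) - L n (L m v) =
          (m - n)%:~R *: L (m + n) v
          + (if m + n == 0 then (m ^+ 3 - m)%:~R / 12%:R * c else 0) *: v].

Definition virasoro_submodule (C : fieldType) (V : lmodType C)
    (L : int -> V -> V) (M N : V -> Prop) : Prop :=
  [/\ subspace N, (forall v, N v -> M v) & forall n v, N v -> N (L n v)].

Definition singular_vector (C : fieldType) (V : lmodType C)
    (L : int -> V -> V) (v : V) : Prop :=
  [/\ v <> 0, (exists h : C, L 0 v = h *: v)
    & forall m : int, 1 <= m -> L m v = 0].

(* M, with the operators L n, is (isomorphic to) L^Vir(c, h). *)
Definition is_LVir (C : fieldType) (V : lmodType C)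
    (L : int -> V -> V) (M : V -> Prop) (c h : C) : Prop :=
  [/\ virasoro_module L M c,
      (exists v, [/\ M v, singular_vector L v, L 0 v = h *: v
         & forall N, virasoro_submodule L M N -> N v -> forall u, M u -> N u])
    & forall N, virasoro_submodule L M N ->
        (forall v, N v -> v = 0) \/ (forall v, M v -> N v)].

(* The modes L(n) = w_(n+1) of a vector w. *)
Definition vir_mode (C : fieldType) (V : vertexSuperalgebra C) (w : V)
    (n : int) (v : V) : V := nprod w (n + 1) v.

(* The vertex subalgebra U, with Virasoro vector w, is the simple Virasoro
   vertex algebra L^Vir(c, 0). *)
Definition is_simple_virasoro_va (C : fieldType) (V : vertexSuperalgebra C)
    (U : V -> Prop) (w : V) (c : C) : Prop :=
  [/\ (forall v, U v <-> va_gen (fun u => u = w) v),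
      virasoro_module (vir_mode w) U c
    & va_simple U].

Section Clifford.

Context {C : numClosedFieldType} {F : vertexSuperalgebra C}.
Implicit Type Phi : 'I_2 -> F.

(* [fmode Phi i n] is the operator Phi_i(n + 1/2): half-integral modes are
   indexed by n : int.  As Phi_i(z) is the sum over r of Phi_i(r) z^(-r-1/2),
   Phi_i(n + 1/2) is the n-th product with Phi_i.  [fmode1] and [fmode2] are
   the cases i = 1 and i = 2. *)
Definition fmode Phi (i : 'I_2) (n : int) (v : F) : F := nprod (Phi i) n v.
Definition fmode1 Phi : int -> F -> F := fmode Phi ord0.
Definition fmode2 Phi : int -> F -> F := fmode Phi ord_max.

(* F is the Clifford vertex superalgebra generated by Phi_1, Phi_2.  In the
   anticommutator (n + 1/2) + (m + 1/2) = 0 reads n + m + 1 = 0.  The Clifford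
   algebra has a unique irreducible vacuum module, so these conditions determine
   F up to isomorphism. *)
Definition clifford_generated Phi : Prop :=
  [/\ vac F <> 0,
      (forall i, va_par true (Phi i)),
      (forall (i j : 'I_2) (n m : int) (v : F),
         fmode Phi i n (fmode Phi j m v) + fmode Phi j m (fmode Phi i n v)
         = if (i == j) && (n + m + 1 == 0) then v else 0)
    & forall v : F, va_gen (fun u => exists i, u = Phi i) v].

(* The kernel of Phi_2(1/2). *)
Definition Fbar Phi (v : F) : Prop := fmode2 Phi 0 v = 0.

Definition omega Phi : F :=
  'i *: fmode2 Phi (-2) (fmode1 Phi (-1) (vac F))
  + fmode1 Phi (-2) (fmode1 Phi (-1) (vac F)).

Definition Lop Phi (n : int) (v : F) : F := vir_mode (omega Phi) n v.

Definition Qop Phi (v : F) : F := Lop Phi (-1) v - vaD v.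

Definition phi_minus Phi (n : int) (v : F) : F :=
  (- (n%:~R / sqrtC 2)) *:
    (fmode1 Phi (n - 1) v + 'i *: fmode2 Phi (n - 1) v).

Definition phi_plus Phi (n : int) (v : F) : F :=
  (- sqrtC 2) *:
    (n%:~R *: fmode1 Phi n v + ('i * (n + 1)%:~R) *: fmode2 Phi n v).

(* A(-n) ... A(-1) 1 *)
Fixpoint descending (A : int -> F -> F) (n : nat) : F :=
  if n is k.+1 then A (- (k.+1)%:Z) (descending A k) else vac F.

Definition w_vec Phi (n j : nat) : F :=
  iter j (Qop Phi) (descending (phi_plus Phi) n).

End Clifford.

(* Main.v *)
(* The modes phi^+(n), phi^-(n) satisfy [phi^+(m), phi^-(n)]_+ = m delta_{m+n,0},
   so that Fbar is the Fock space of symplectic fermions, on which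
   L(m) = sum_{a+b=m} :phi^-(a) phi^+(b):, and Q is the derivation with
   phi^+ -> 2 phi^- -> 0.  It carries a nondegenerate symmetric form for which
   phi^+-(n) is adjoint to +-phi^+-(-n), L(m) to L(-m) and Q to itself.

   The point is that all singular vectors are combinations of the w_{n,j}.  Let
   v be singular of weight h, let n be the smallest number of creation operators
   occurring in v, and look at the part u of degree n of v.  As L(m) v = 0 in
   degree n - 2, the product phi^-(z) phi^+(z) of annihilation parts kills u; as
   phi^+-(z) :phi^-(z) phi^+(z): = 0, degree n gives a second-order equation on u,
   whose leading coefficient yields h = M (M + 1) / 2 for the largest mode M
   acting nontrivially on u.  Vanishing on the diagonals bounds h by
   M + (M - 1) + ... + (M - n + 1), so M = n, and then u is determined by the
   n + 1 numbers obtained by applying modes n, ..., 1 of prescribed types, which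
   up to nonzero factors are the products of v with the w_{n,j}.

   By duality in each (finite-dimensional) weight space the w_{n,j} generate Fbar
   over the Virasoro algebra.  The form pairs w_{n,j} with w_{n,n-j} only, hence
   the modules generated by the w_{n,j} are irreducible and their sum is direct. *)

Require Import Defs.
From mathcomp Require Import all_boot all_order all_algebra.
From mathcomp Require Import complex reals.
From HB Require Import structures.
From mathcomp Require Import boolp ring lra zify.

Set Implicit Arguments.
Unset Strict Implicit.
Unset Printing Implicit Defensive.

Import Order.TTheory GRing.Theory Num.Theory.
Local Open Scope ring_scope.

(** The Fock space comes without basis or grading; the relations only make the vacuum cyclic. The
    substitute is the polynomial (L(0) - 1) ... (L(0) - N), which kills the weights 1, ..., N but
    not the vacuum, and so singles out the vacuum coefficient [vev]. The form is [vev] after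
    application of a transposed word; the degree filtration counts the annihilation operators needed
    before [vev] sees a vector. The value M (M + 1) / 2 arises as M, the weight removed by phi(M),
    plus 1 + ... + (M - 1), the coefficients in [L(M - a), phi(a)] = - a phi(M). The weight bound
    then reads (M - n) (M - n + 1) <= 0, which forces M = n. The coefficients of phi^+ and phi^- fit
    Fbar: Phi_2(-1/2), the mode paired with Phi_2(1/2), has coefficient 0 in both, and all other
    Clifford modes can be recovered from them. *)

Definition pairing_coef (C : nzRingType) (e : bool) (m : int) (e' : bool)
    (n : int) : C :=
  if (e != e') && (m + n == 0) then (if e then m else - m)%:~R else 0.

Definition central_coef (C : fieldType) (c : C) (m n : int) : C :=
  if m + n == 0 then (m ^+ 3 - m)%:~R / 12%:R * c else 0.

Lemma central_coef0 (C : fieldType) (c : C) n : central_coef c 0 n = 0.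
Proof. by rewrite /central_coef expr0n /= subrr mulr0z !mul0r if_same. Qed.

Lemma central_coef_ne (C : fieldType) (c : C) m n :
  m + n != 0 -> central_coef c m n = 0.
Proof. by rewrite /central_coef => /negbTE ->. Qed.

(* The vacuum module of symplectic fermions: [sfP true n] and [sfP false n] are
   phi^+(n) and phi^-(n), [sfL] are the Virasoro modes, [sfQ] is the screening
   operator. *)
Record symplecticFermion (C : numFieldType) (V : lmodType C) :=
  SymplecticFermion {
  sfP : bool -> int -> {linear V -> V};
  sfL : int -> {linear V -> V};
  sfQ : {linear V -> V};
  sfvac : V;
  sfvac_neq0 : sfvac != 0;
  sfPP : forall e m e' n v, sfP e m (sfP e' n v) =
           pairing_coef C e m e' n *: v - sfP e' n (sfP e m v);
  sfP_vac : forall e (n : int), 0 <= n -> sfP e n sfvac = 0;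
  sfLP : forall m e n v, sfL m (sfP e n v) =
           sfP e n (sfL m v) - n%:~R *: sfP e (m + n) v;
  sfL_vac : forall m : int, -1 <= m -> sfL m sfvac = 0;
  sfL2_vac : sfL (-2) sfvac = sfP false (-1) (sfP true (-1) sfvac);
  sfLL : forall m n v, sfL m (sfL n v) = sfL n (sfL m v)
           + (m - n)%:~R *: sfL (m + n) v + central_coef (- 2%:R) m n *: v;
  sfQP_true : forall n v,
    sfQ (sfP true n v) = sfP true n (sfQ v) + 2%:R *: sfP false n v;
  sfQP_false : forall n v, sfQ (sfP false n v) = sfP false n (sfQ v);
  sfQ_vac : sfQ sfvac = 0;
  sfP_span : forall S : V -> Prop, subspace S -> S sfvac ->
    (forall e n v, S v -> S (sfP e n v)) -> forall v, S v
}.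

Section SubspaceTheory.
Context {C : numFieldType} {V : lmodType C}.
Implicit Types (S : V -> Prop).

Lemma subspaceD S u v : subspace S -> S u -> S v -> S (u + v).
Proof. by case=> _ h Su Sv; rewrite -[u]scale1r; exact: h. Qed.

Lemma subspaceZ S a u : subspace S -> S u -> S (a *: u).
Proof. by case=> h0 h Su; rewrite -[_ *: _]addr0; exact: h. Qed.

Lemma subspaceZ_inv S a u : subspace S -> a != 0 -> S (a *: u) -> S u.
Proof. by move=> hS a0 /(subspaceZ a^-1 hS); rewrite scalerA mulVf // scale1r. Qed.

Lemma subspaceN S u : subspace S -> S u -> S (- u).
Proof. by move=> hS Su; rewrite -scaleN1r; exact: subspaceZ. Qed.

Lemma subspaceB S u v : subspace S -> S u -> S v -> S (u - v).
Proof. by move=> hS Su Sv; apply: subspaceD => //; exact: subspaceN. Qed.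

Lemma subspace_sum S (I : Type) (r : seq I) (p : pred I) (f : I -> V) :
  subspace S -> (forall i, p i -> S (f i)) -> S (\sum_(i <- r | p i) f i).
Proof.
move=> hS Sf; elim/big_ind: _ => // [|u v Su Sv]; first by case: hS.
exact: subspaceD.
Qed.

Lemma subspace_ker (W : lmodType C) (f : {linear V -> W}) :
  subspace (fun v => f v = 0).
Proof.
by split=> [|a u v fu fv]; rewrite ?linear0 // linearP fu fv scaler0 addr0.
Qed.

End SubspaceTheory.

(** * Symplectic fermions *)

Section FockSpace.
Context {C : numFieldType} {V : lmodType C} (F : symplecticFermion V).
Local Notation P := (sfP F).
Local Notation L := (sfL F).
Local Notation Q := (sfQ F).
Local Notation vac := (sfvac F).

(** The pairing with a zero mode carries the factor 0, so [P e 0] anticommutes with every mode;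
    killing the cyclic vacuum, it kills everything. *)
Lemma sfP0 e v : P e 0 v = 0.
Proof.
apply: (sfP_span (s := F) (subspace_ker (P e 0))) => [|e' n u u0].
  exact: sfP_vac.
rewrite sfPP u0 linear0 subr0 /pairing_coef add0r.
by case: ifP => _; rewrite ?oppr0 ?if_same ?mulr0z ?scale0r.
Qed.

Inductive creation_span : V -> Prop :=
  | CreationVac : creation_span vac
  | Creation0 : creation_span 0
  | CreationLin a u v :
      creation_span u -> creation_span v -> creation_span (a *: u + v)
  | CreationP e a v : (0 < a)%N -> creation_span v ->
      creation_span (P e (- a%:Z) v).

Lemma creation_span_subspace : subspace creation_span.
Proof. by split; [exact: Creation0 | move=> *; exact: CreationLin]. Qed.

(** Normal ordering: an annihilation operator is moved to the right until it meets the vacuum, each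
    exchange leaving a multiple of a shorter product. *)
Lemma creation_spanT v : creation_span v.
Proof.
have cS := creation_span_subspace.
apply: (sfP_span (s := F) cS) => [|e n {}v]; first exact: CreationVac.
case: (ltrP n 0) => [n0 Sv|n0].
  have -> : n = - (`|n|%N)%:Z by lia.
  by apply: CreationP => //; lia.
elim=> {v} [||a u v _ Su _ Sv|e' a v a0 cv Sv].
- by rewrite sfP_vac //; exact: Creation0.
- by rewrite linear0; exact: Creation0.
- by rewrite linearP; exact: CreationLin.
- by rewrite sfPP; apply: subspaceB => //; [exact: subspaceZ | exact: CreationP].
Qed.

Lemma creation_ind (S : V -> Prop) : subspace S -> S vac ->
  (forall e a v, (0 < a)%N -> S v -> S (P e (- a%:Z) v)) -> forall v, S v.
Proof.
move=> hS S1 SP v; elim: (creation_spanT v) => {v} [||a u v _ Su _ Sv|e a v a0 _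
  Sv] //.
- by case: hS.
- by case: hS => _; exact.
- exact: SP.
Qed.

(** * Weights and the vacuum coefficient *)

Definition weight (g : nat) (x : V) : Prop := L 0 x = g%:R *: x.

Lemma weight_vac : weight 0 vac.
Proof. by rewrite /weight sfL_vac // scale0r. Qed.

Lemma weight_subspace g : subspace (weight g).
Proof.
split=> [|a u v]; rewrite /weight ?linear0 ?scaler0 // linearP => -> ->.
by rewrite scalerDr !scalerA mulrC.
Qed.

Lemma weight_creation g e a x : weight g x -> weight (g + a) (P e (- a%:Z) x).
Proof.
rewrite /weight sfLP add0r => ->; rewrite linearZZ -scalerBl natrD.
by rewrite rmorphN opprK.
Qed.

Lemma weight_annihil g e a x : (a <= g)%N -> weight g x ->
  weight (g - a) (P e a%:Z x).
Proof.
rewrite /weight sfLP add0r => ag ->; rewrite linearZZ -scalerBl natrB //.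
Qed.

Lemma weight_L0E m g x : weight g x ->
  L 0 (L m x) = (g%:R - m%:~R) *: L m x.
Proof.
rewrite /weight sfLL => ->; rewrite central_coef0 !add0r linearZZ.
by rewrite scale0r addr0 -scalerDl rmorphN.
Qed.

Lemma weight_L (m : int) g g' x : g%:Z - m = g'%:Z -> weight g x -> weight g' (L m x).
Proof.
move=> e w; rewrite /weight (weight_L0E _ w); congr (_ *: _).
by rewrite [g'%:R]pmulrn -e rmorphB.
Qed.

(** The polynomial (L(0) - 1) ... (L(0) - N): it removes the weights 1, ..., N and keeps weight
    0. *)
Fixpoint shave (N : nat) (x : V) : V :=
  if N is k.+1 then shave k (L 0 x - k.+1%:R *: x) else x.

Lemma shave_linear N : linear (shave N).
Proof.
elim: N => //= N IH a u v; rewrite -IH; congr shave.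
by rewrite linearP scalerDr scalerBr opprD !scalerA [N.+1%:R * a]mulrC addrACA.
Qed.

Lemma shaveZ N a x : shave N (a *: x) = a *: shave N x.
Proof. exact: (scalable_linear (@shave_linear N)). Qed.

Lemma shaveB N x y : shave N (x - y) = shave N x - shave N y.
Proof. by rewrite -scaleN1r addrC shave_linear scaleN1r addrC. Qed.

Lemma shave0 N : shave N 0 = 0.
Proof. by rewrite -(scale0r 0) shaveZ !scale0r. Qed.

Lemma shave_eigen N (l : C) x : L 0 x = l *: x ->
  shave N x = \prod_(1 <= g < N.+1) (l - g%:R) *: x.
Proof.
elim: N => [|N IH] lx /=; first by rewrite big_geq // scale1r.
by rewrite lx -scalerBl shaveZ IH // [in RHS]big_nat_recr //= scalerA mulrC.
Qed.

Lemma shave_L0 N x : shave N (L 0 x) = L 0 (shave N x).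
Proof. by elim: N x => //= N IH x; rewrite -IH; congr shave;
  rewrite (linearB (L 0)) (linearZZ (L 0)). Qed.

Lemma shave_le N N' x : (N <= N')%N -> shave N x = 0 -> shave N' x = 0.
Proof.
elim: N' x => [|N' IH] x; first by rewrite leqn0 => /eqP ->.
rewrite leq_eqVlt => /orP[/eqP <- //|NN' x0] /=.
by rewrite shaveB shaveZ shave_L0 IH // linear0 scaler0 subr0.
Qed.

(** [P e (- a)] raises L(0) by a, so the factors for a + 1, ..., a + N pass through it as those for
    1, ..., N; the factors for 1, ..., a stay outside. *)
Lemma shave_creation N e a x :
  shave (N + a) (P e (- a%:Z) x) = shave a (P e (- a%:Z) (shave N x)).
Proof.
elim: N x => //= N IH x; rewrite -IH; congr shave.
rewrite sfLP add0r (linearB (P _ _)) (linearZZ (P _ _)) -addrA -opprD -scalerDl.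
by congr (_ - _ *: _); rewrite -addSn natrD rmorphN addrC addrK.
Qed.

(** Stands for the sum of the weight spaces of weight at least 1. *)
Definition positive_part (x : V) : Prop := exists N, shave N x = 0.

Lemma positive_part_subspace : subspace positive_part.
Proof.
split=> [|a u v [N u0] [N' v0]]; first by exists 0%N.
exists (maxn N N'); rewrite shave_linear (shave_le _ u0) ?leq_maxl //.
by rewrite (shave_le _ v0) ?leq_maxr // scaler0 addr0.
Qed.

Lemma positive_part_creation e a x c : (0 < a)%N ->
  positive_part (x - c *: vac) -> positive_part (P e (- a%:Z) x).
Proof.
move=> a0 hx; have pS := positive_part_subspace.
rewrite -[x](subrK (c *: vac)) linearD; apply: subspaceD => //.
  by case: hx => N y0; exists (N + a)%N; rewrite shave_creation y0 linear0 shave0.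
rewrite linearZ; apply: subspaceZ => //; exists a.
case: a a0 => // a _ /=.
have := weight_creation e a.+1 weight_vac; rewrite /weight add0n => ->.
by rewrite subrr shave0.
Qed.

Lemma vac_decomp x : exists c, positive_part (x - c *: vac).
Proof.
have pS := positive_part_subspace.
elim/creation_ind: x => [||e a v a0 [c hv]].
- split=> [|k u v [c hu] [c' hv]]; first by exists 0; rewrite scale0r subrr; case: pS.
  exists (k * c + c'); rewrite scalerDl opprD addrACA -scalerA -scalerBr.
  by case: pS => _; exact.
- by exists 1; rewrite scale1r subrr; case: pS.
- by exists 0; rewrite scale0r subr0; exact: positive_part_creation hv.
Qed.

Lemma prod_subn_neq0 N (l : C) : (forall g, (0 < g)%N -> l != g%:R) ->
  \prod_(1 <= g < N.+1) (l - g%:R) != 0.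
Proof.
move=> lg; rewrite big_seq_cond prodf_seq_neq0; apply/allP => g /=.
by rewrite mem_index_iota => /andP[g1 _]; rewrite subr_eq0 lg ?implybT.
Qed.

(** On the vacuum [shave N] is the scalar (-1) (-2) ... (-N), nonzero in characteristic 0. *)
Lemma vac_notin_positive c : positive_part (c *: vac) -> c = 0.
Proof.
case=> N; rewrite shaveZ (@shave_eigen _ 0) ?sfL_vac ?scale0r // scalerA.
move/eqP; rewrite scaler_eq0 (negbTE (sfvac_neq0 F)) orbF mulf_eq0.
rewrite (negbTE (prod_subn_neq0 _ _)) ?orbF => [/eqP //|g g0].
by rewrite eq_sym pnatr_eq0 -lt0n.
Qed.

(** Each vector is killed by a polynomial in L(0) with simple roots 0, ..., N; this makes L(0)
    diagonalisable with natural eigenvalues. *)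
Lemma L0_shave_eq0 x : exists N, L 0 (shave N x) = 0.
Proof.
have [c [N xc]] := vac_decomp x; exists N.
move: xc; rewrite shaveB shaveZ (@shave_eigen _ 0 vac) ?sfL_vac ?scale0r //.
by move/subr0_eq ->; rewrite !(linearZZ (L 0)) sfL_vac // !scaler0.
Qed.

Lemma eigen_eq0 (l : C) x : (forall g : nat, l != g%:R) -> L 0 x = l *: x -> x = 0.
Proof.
move=> lg lx; have [N] := L0_shave_eq0 x; rewrite (shave_eigen _ lx) linearZ lx /=.
rewrite scalerA => /eqP; rewrite scaler_eq0 mulf_eq0 (negbTE (lg 0%N)) orbF.
by rewrite (negbTE (prod_subn_neq0 _ _)) // => /eqP.
Qed.

Lemma weight_neg_eq0 k x : (0 < k)%N -> L 0 x = - k%:R *: x -> x = 0.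
Proof.
move=> k0; apply: eigen_eq0 => g.
by rewrite -subr_eq0 -opprD oppr_eq0 -natrD pnatr_eq0 addn_eq0 negb_and -lt0n k0.
Qed.

Lemma annihil_eq0 g a e x : (g < a)%N -> weight g x -> P e a%:Z x = 0.
Proof.
rewrite /weight => ga w; apply: (@weight_neg_eq0 (a - g)); first by rewrite subn_gt0.
rewrite sfLP add0r w linearZZ -scalerBl natrB 1?ltnW //.
by rewrite opprB.
Qed.

Lemma weight_L_eq0 (m : int) g x : g%:Z < m -> weight g x -> L m x = 0.
Proof.
move=> gm w; apply: (@weight_neg_eq0 `|m - g%:Z|%N); first by lia.
rewrite (weight_L0E _ w); congr (_ *: _).
have -> : m%:~R = (`|m - g%:Z|%N)%:R + g%:R :> C.
  by rewrite -natrD -[RHS]/((_ + _)%N%:Z%:~R); congr (_%:~R); lia.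
by rewrite opprD addrCA subrr addr0.
Qed.

Lemma weight0P x : weight 0 x -> exists c, x = c *: vac.
Proof.
rewrite /weight scale0r => x0; have [c [N xc]] := vac_decomp x; exists c.
apply/subr0_eq; move: xc; rewrite (@shave_eigen _ 0); last first.
  by rewrite linearB linearZZ x0 sfL_vac // scaler0 subrr scale0r.
move/eqP; rewrite scaler_eq0 => /orP[|/eqP //].
by rewrite (negbTE (prod_subn_neq0 _ _)) // => g g0; rewrite eq_sym pnatr_eq0 -lt0n.
Qed.

(* Apply the factors [L 0 - g] of [L 0 (shave N x) = 0] one by one: the last
   nonzero vector obtained is homogeneous. *)
Lemma homogeneous_in (S : V -> Prop) x : subspace S ->
  (forall y, S y -> S (L 0 y)) -> S x -> x <> 0 ->
  exists g y, [/\ S y, y <> 0 & weight g y].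
Proof.
move=> hS SL Sx x0; have [N N0] := L0_shave_eq0 x.
have Ssh k y : S y -> S (shave k y).
  elim: k y => //= k IH y Sy; apply: IH; apply: subspaceB; auto.
  exact: subspaceZ.
have [NN|NN] := eqVneq (shave N x) 0; last first.
  exists 0%N, (shave N x); split; auto; first exact/eqP.
  by rewrite /weight scale0r.
elim: N x Sx x0 NN {N0} => [|N IH] x Sx x0 //= NN.
have [xN|/eqP xN] := eqVneq (L 0 x - N.+1%:R *: x) 0.
  by exists N.+1, x; split=> //; exact: subr0_eq.
apply: (IH _ _ xN NN); apply: subspaceB; auto; exact: subspaceZ.
Qed.

(** Vacuum expectation value: the coordinate along [vac] in the splitting of the space into the
    vacuum line and [positive_part]. *)
Definition vev (x : V) : C := projT1 (cid (vac_decomp x)).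

Lemma vevP x c : positive_part (x - c *: vac) -> vev x = c.
Proof.
move=> xc; rewrite /vev; case: cid => c' /= xc'; apply/subr0_eq/vac_notin_positive.
rewrite scalerBl -[_ *: vac](subrK x) -addrA -opprB addrC.
by apply: subspaceB => //; exact: positive_part_subspace.
Qed.

Lemma vev_decomp x : positive_part (x - vev x *: vac).
Proof. by rewrite /vev; case: cid. Qed.

Lemma vev_linear : linear (vev : V -> C^o).
Proof.
move=> a u v; apply: vevP; rewrite scalerDl opprD addrACA -scalerA -scalerBr.
by case: positive_part_subspace => _; apply; exact: vev_decomp.
Qed.

HB.instance Definition _ := GRing.isLinear.Build C V C^o _ vev vev_linear.

Lemma vevD x y : vev (x + y) = vev x + vev y.
Proof. exact: linearD. Qed.

Lemma vevB x y : vev (x - y) = vev x - vev y.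
Proof. exact: linearB. Qed.

Lemma vevZ a x : vev (a *: x) = a * vev x.
Proof. exact: linearZ. Qed.

Lemma vev0 : vev 0 = 0.
Proof. exact: linear0. Qed.

Lemma vev_vac : vev vac = 1.
Proof. by apply: vevP; rewrite scale1r subrr; case: positive_part_subspace. Qed.

Lemma vev_creation e a x : vev (P e (- a%:Z) x) = 0.
Proof.
case: a => [|a]; first by rewrite oppr0 sfP0 linear0.
apply: vevP; rewrite scale0r subr0.
exact: positive_part_creation (vev_decomp x).
Qed.

End FockSpace.

(** * The contravariant form *)

Section ContravariantForm.
Context {C : numFieldType} {V : lmodType C} (F : symplecticFermion V).
Local Notation P := (sfP F).
Local Notation L := (sfL F).
Local Notation Q := (sfQ F).
Local Notation vac := (sfvac F).
Local Notation vev := (vev F).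

Lemma pairing_same e m n : pairing_coef C e m e n = 0.
Proof. by rewrite /pairing_coef eqxx. Qed.

Lemma pairing_ne e m e' n : m + n != 0 -> pairing_coef C e m e' n = 0.
Proof. by rewrite /pairing_coef => /negbTE ->; rewrite andbF. Qed.

Lemma pairing_true m n :
  pairing_coef C true m false n = if m + n == 0 then m%:~R else 0.
Proof. by []. Qed.

Lemma pairing_false m n :
  pairing_coef C false m true n = if m + n == 0 then - m%:~R else 0.
Proof. by rewrite /pairing_coef /= rmorphN. Qed.

Lemma PP_anti e m e' n v : m + n != 0 -> P e m (P e' n v) = - P e' n (P e m v).
Proof. by move=> mn; rewrite sfPP pairing_ne // scale0r sub0r. Qed.

Lemma PP_same e m n v : P e m (P e n v) = - P e n (P e m v).
Proof. by rewrite sfPP pairing_same scale0r sub0r. Qed.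

(* L(m), m >= 0, with the normally ordered series cut off at N. *)
Definition sugawara (N m : nat) (x : V) : V :=
  \sum_(1 <= b < N) (P false (- b%:Z) (P true (b + m)%N x)
                     - P true (- b%:Z) (P false (b + m)%N x))
  + \sum_(1 <= a < m) P false a (P true (m - a)%N x).

Lemma sugawara_linear N m : linear (sugawara N m).
Proof.
move=> k u v; rewrite /sugawara scalerDr !scaler_sumr addrACA -!big_split /=.
congr (_ + _); apply: eq_bigr => b _; last by rewrite !(linearP (P _ _)).
by rewrite !(linearP (P _ _)) scalerBr opprD addrACA.
Qed.

(** [P e (- c)] contracts with one quadratic term: in the first sum at b = c - m when c > m, in the
    second when c < m. For c = m nothing contracts, and the last term is a zero mode. The condition
    c < N keeps b = c - m in range. *)
Lemma sugawara_creation N m e c v : (0 < c < N)%N ->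
  sugawara N m (P e (- c%:Z) v)
  = P e (- c%:Z) (sugawara N m v) + c%:R *: P e (m%:Z - c%:Z) v.
Proof.
move=> /andP[c0 cN].
have H1 b : (0 < b)%N ->
    P false (- b%:Z) (P true (b + m)%N (P e (- c%:Z) v))
    - P true (- b%:Z) (P false (b + m)%N (P e (- c%:Z) v))
    = P e (- c%:Z) (P false (- b%:Z) (P true (b + m)%N v)
                     - P true (- b%:Z) (P false (b + m)%N v))
      + (if (b + m == c)%N then c%:R *: P e (- b%:Z) v else 0).
  move=> b0.
  rewrite !(sfPP F _ (b + m)%N) !(linearB (P _ _)) !(linearZZ (P _ _)).
  rewrite ![P _ (- b%:Z) (P e _ _)]PP_anti; try lia.
  rewrite !opprK; case: e; rewrite pairing_same ?pairing_true ?pairing_false scale0r;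
    have -> : (((b + m)%N%:Z + - c%:Z) == 0) = (b + m == c)%N by lia.
  - rewrite add0r opprD addrA addrAC; congr (_ + _).
    by case: eqP => [->|_]; rewrite ?scaleNr ?opprK // scale0r oppr0.
  - rewrite add0r -addrA addrC; congr (_ + _).
    by case: eqP => [->|_]; rewrite ?scale0r.
have H2 a : (0 < a < m)%N ->
    P false a (P true (m - a)%N (P e (- c%:Z) v))
    = P e (- c%:Z) (P false a (P true (m - a)%N v))
      + (if ((a == if e then c else m - c) && (c < m))%N then c%:R *: P e (m%:Z -
        c%:Z) v else 0).
  move=> a0.
  rewrite (sfPP F _ (m - a)%N) (linearB (P _ _)) (linearZZ (P _ _)) (sfPP F false a
    e) opprB.
  rewrite addrCA; congr (_ + _).
  case: (e); rewrite pairing_same ?pairing_true ?pairing_false scale0r.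
  - rewrite add0r.
    have -> : ((a%:Z + - c%:Z) == 0) = ((a == c) && (c < m))%N by lia.
    case: ifP => [/andP[/eqP -> cm]|_]; last by rewrite scale0r oppr0.
    rewrite scaleNr opprK; congr (_ *: P _ _ _); lia.
  - rewrite subr0.
    have -> : (((m - a)%N%:Z + - c%:Z) == 0) = ((a == m - c) && (c < m))%N by lia.
    case: ifP => [/andP[/eqP -> cm]|_]; last by rewrite scale0r.
    congr (_ *: P _ _ _); try lia.
    by rewrite subKn // ltnW.
rewrite /sugawara.
rewrite (eq_big_nat _ _ (fun b hb => H1 b (proj1 (andP hb)))) (eq_big_nat _ _ H2).
rewrite 2!big_split /= -!(linear_sum (P _ _)) (linearD (P _ _)) addrACA;
  congr (_ + _).
have [cm|mc] := ltnP c m.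
  rewrite big1_seq ?add0r; last first.
    by move=> b /andP[_]; rewrite mem_index_iota => b0; rewrite ifF //; lia.
  rewrite (eq_bigr (fun i => if (i == (if e then c else m - c))%N then c%:R *: P e
    (m%:Z - c%:Z) v else 0)); last first.
    by move=> i _; rewrite andbT.
  rewrite -big_mkcond big_nat1_eq ifT //; case: (e); lia.
rewrite [X in _ + X]big1 ?addr0; last by move=> i _; rewrite andbF.
have -> : m%:Z - c%:Z = - (c - m)%N%:Z by lia.
move: mc; rewrite leq_eqVlt => /orP[/eqP mc|mc].
  rewrite mc subnn oppr0 sfP0 scaler0 big1_seq // => b;
    rewrite mem_index_iota => /andP[_ b0].
  by rewrite ifF //; lia.
rewrite (eq_bigr (fun b => if b == (c - m)%N then c%:R *: P e (- (c - m)%N%:Z) v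
  else 0)); last first.
  move=> b _; have -> : (b + m == c)%N = (b == c - m)%N by lia.
  by case: eqP => // ->.
by rewrite -big_mkcond big_nat1_eq ifT //; lia.
Qed.

(** Both sides kill the vacuum and have the same commutators with creation operators. *)
Lemma sugawaraP (m : nat) x :
  exists N0, forall N, (N0 <= N)%N -> L m%:Z x = sugawara N m x.
Proof.
elim/(creation_ind (F := F)): x => [||e c v c0 [N0 IH]].
- split=> [|k u v [N1 h1] [N2 h2]].
    exists 0%N => N _; rewrite linear0 /sugawara.
    rewrite !big1 ?addr0 // => b _; by rewrite !(linear0 (P _ _)) ?subr0.
  exists (maxn N1 N2) => N; rewrite geq_max => /andP[n1 n2].
  by rewrite linearP (h1 N) // (h2 N) // sugawara_linear.
- exists 0%N => N _; rewrite sfL_vac // /sugawara.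
  have h e (k : nat) : P e k%:Z vac = 0 by exact: sfP_vac.
  by rewrite !big1 ?addr0 // => b _; rewrite !h !(linear0 (P _ _)) ?subr0.
- exists (maxn N0 c.+1) => N; rewrite geq_max => /andP[n1 n2].
  rewrite sugawara_creation ?c0 // sfLP (IH N) // rmorphN scaleNr opprK.
  by [].
Qed.

(** * Transposition of words and the symmetric form *)

Definition sgn (e : bool) : C := if e then 1 else -1.

Lemma sgnK e : sgn e * sgn e = 1.
Proof. by case: e; rewrite /sgn ?mulrNN mulr1. Qed.

(* The anti-involution phi^+(n) -> phi^+(-n), phi^-(n) -> - phi^-(-n) fixes Q and
   sends L(m) to L(-m); it makes charge k dual to charge - k. *)
Definition transp (l : bool * int) (x : V) : V := sgn l.1 *: P l.1 (- l.2) x.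

Definition op (w : seq (bool * int)) (x : V) : V :=
  foldr (fun l y => P l.1 l.2 y) x w.

(** The transpose of [op w]: the letter that [op] applies last is transposed and applied first. *)
Definition optr (w : seq (bool * int)) (x : V) : V :=
  foldl (fun y l => transp l y) x w.

(* Wick's rule: the words obtained by contracting l with one letter of w, with
   their coefficients. *)
Fixpoint contract (l : bool * int) (w : seq (bool * int)) :
    seq (C * seq (bool * int)) :=
  if w is x :: w' then
    (pairing_coef C l.1 l.2 x.1 x.2, w')
      :: [seq (- p.1, x :: p.2) | p <- contract l w']
  else [::].

Lemma contract_size l w p : p \in contract l w -> (size p.2 < size w)%N.
Proof.
elim: w p => //= x w IH p; rewrite inE => /orP[/eqP -> //|].
by case/mapP => q /IH qw -> /=.
Qed.

Lemma transp_linear l : linear (transp l).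
Proof. by move=> a u v; rewrite /transp linearP scalerDr !scalerA mulrC. Qed.

Lemma optr_linear w : linear (optr w).
Proof.
elim: w => [|l w IH] a u v //.
rewrite /optr /= -!/(optr _ _) -IH.
congr optr.
by rewrite transp_linear.
Qed.

Lemma optrD w u v : optr w (u + v) = optr w u + optr w v.
Proof. by rewrite -[u]scale1r optr_linear !scale1r. Qed.

Lemma optr0 w : optr w 0 = 0.
Proof. by have := optrD w 0 0; rewrite addr0 => /eqP;
  rewrite -subr_eq subrr eq_sym => /eqP. Qed.

Lemma optrZ w a u : optr w (a *: u) = a *: optr w u.
Proof. by rewrite -[_ *: u]addr0 optr_linear optr0 addr0. Qed.

Lemma op_annihil l w : 0 <= l.2 ->
  P l.1 l.2 (op w vac) = \sum_(p <- contract l w) p.1 *: op p.2 vac.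
Proof.
move=> l0; elim: w => /= [|x w IH]; first by rewrite big_nil sfP_vac.
rewrite big_cons big_map /= sfPP IH linear_sum -sumrN; congr (_ + _).
by apply: eq_bigr => p _; rewrite linearZZ scaleNr.
Qed.

Lemma transp_anti l x y : transp x (transp l y)
  = pairing_coef C l.1 l.2 x.1 x.2 *: y - transp l (transp x y).
Proof.
case: l x => [e m] [e' n]; rewrite /transp /= !(linearZZ (P _ _)) !scalerA sfPP
  scalerBr scalerA [in RHS]mulrC.
congr (_ *: _ - _); case: e e' => [] [] /=;
  rewrite ?pairing_same ?mulr0 // ?pairing_true ?pairing_false.
- have -> : (- n - m == 0) = (m + n == 0) by lia.
  case: ifP; rewrite ?mulr0 // => mn.
  have -> : n = - m by lia.
  by rewrite opprK /sgn mulr1 mulrNN mul1r.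
- have -> : (- n - m == 0) = (m + n == 0) by lia.
  case: ifP; rewrite ?mulr0 // => mn.
  have -> : n = - m by lia.
  by rewrite opprK /sgn mul1r mulN1r.
Qed.

Lemma optr_transp l w y : optr w (transp l y) =
  \sum_(p <- contract l w) p.1 *: optr p.2 y
  + (-1) ^+ size w *: transp l (optr w y).
Proof.
elim: w y => /= [|x w IH] y; first by rewrite big_nil add0r scale1r.
rewrite big_cons big_map /= transp_anti optrD optrZ -scaleN1r optrZ IH scaleN1r.
rewrite opprD addrA; congr (_ + _ + _).
  by rewrite -sumrN; apply: eq_bigr => p _; rewrite scaleNr.
by rewrite exprS mulN1r scaleNr.
Qed.

Lemma vev_transp l y : 0 <= l.2 -> vev (transp l y) = 0.
Proof.
move=> l0; rewrite /transp vevZ.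
have -> : l.2 = `|l.2|%N%:Z by lia.
by rewrite vev_creation mulr0.
Qed.

(** Induction on the length. A leading annihilation operator is contracted with the same
    coefficients on both sides, and the uncontracted term, whose outermost operator is then a
    creation operator, has no vacuum part. A leading creation operator gives 0 on the left, and its
    transpose kills the vacuum on the right. *)
Lemma vev_optr w : vev (op w vac) = vev (optr w vac).
Proof.
have [n] := ubnP (size w); elim: n w => // n IH [|l w] //= wn.
have [l0|l0] := lerP 0 l.2.
  rewrite op_annihil // optr_transp vevD vevZ vev_transp // mulr0 addr0.
  have H f : vev (\sum_(p <- contract l w) p.1 *: f p.2) = \sum_(p <- contract l w)
    p.1 * vev (f p.2).
    elim: (contract l w) => [|p s IHs]; first by rewrite !big_nil vev0.
    by rewrite !big_cons vevD vevZ IHs.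
  rewrite (H (fun w => op w vac)) (H (fun w => optr w vac)).
  apply: eq_big_seq => p /contract_size pw; congr (_ * _); apply: IH.
  by apply: (leq_trans pw); exact: ltnW wn.
have {1}-> : l.2 = - `|l.2|%N%:Z by lia.
rewrite vev_creation /transp sfP_vac ?scaler0 ?optr0 ?vev0 //; lia.
Qed.

Definition wtr (w : seq (bool * int)) := rev [seq (l.1, - l.2) | l <- w].
Definition wsgn (w : seq (bool * int)) : C := \prod_(l <- w) sgn l.1.

Lemma op_cat w w' x : op (w ++ w') x = op w (op w' x).
Proof. exact: foldr_cat. Qed.

Lemma optr_cat w w' x : optr (w ++ w') x = optr w' (optr w x).
Proof. exact: foldl_cat. Qed.

Lemma op_linear w : linear (op w).
Proof.
elim: w => [|l w IH] a u v //.
by rewrite /op /= -!/(op _ _) IH (linearP (P _ _)).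
Qed.

Lemma optrE w x : optr w x = wsgn w *: op (wtr w) x.
Proof.
rewrite /wtr /wsgn; elim: w x => [|l w IH] x; first by rewrite big_nil scale1r.
rewrite /= rev_cons -cats1 op_cat IH big_cons mulrC -scalerA; congr (_ *: _).
rewrite /transp /= -[_ *: _]addr0 op_linear.
suff -> : op (rev [seq (l0.1, - l0.2) | l0 <- w]) 0 = 0 by rewrite addr0.
by elim: (rev _) => //= p s ->; rewrite linear0.
Qed.

Lemma wtrK w : wtr (wtr w) = w.
Proof.
rewrite /wtr map_rev revK -map_comp -[RHS]map_id; apply: eq_map => -[e n] /=.
by rewrite opprK.
Qed.

Lemma wsgn_tr w : wsgn (wtr w) = wsgn w.
Proof.
rewrite /wsgn /wtr (perm_big [seq (l.1, - l.2) | l <- w]) ?perm_rev //.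
by rewrite big_map.
Qed.

Lemma wsgnK w : wsgn w * wsgn w = 1.
Proof. by rewrite /wsgn -big_split /= big1 // => l _; rewrite sgnK. Qed.

Lemma vev_optr_sym p q : vev (optr p (op q vac)) = vev (optr q (op p vac)).
Proof.
rewrite [optr p _]optrE vevZ -op_cat vev_optr optr_cat.
rewrite [optr (wtr p) _]optrE wtrK wsgn_tr optrZ vevZ mulrA wsgnK mul1r.
by [].
Qed.

Lemma word_span x :
  exists s : seq (C * seq (bool * int)), x = \sum_(p <- s) p.1 *: op p.2 vac.
Proof.
pattern x; apply: (sfP_span (s := F)) => {x} [||e n v [s ->]].
- split=> [|a u v [s ->] [t ->]]; first by exists [::]; rewrite big_nil.
  exists ([seq (a * p.1, p.2) | p <- s] ++ t); rewrite big_cat big_map scaler_sumr.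
  by congr (_ + _); apply: eq_bigr => p _; rewrite scalerA.
- by exists [:: (1, [::])]; rewrite big_seq1 scale1r.
- exists [seq (p.1, (e, n) :: p.2) | p <- s]; rewrite big_map linear_sum.
  by apply: eq_bigr => p _; rewrite linearZZ.
Qed.

(** The expansion of x in words is an arbitrary choice; [cform_op] shows that the value does not
    depend on it. *)
Definition cform (x y : V) : C :=
  \sum_(p <- projT1 (cid (word_span x))) p.1 * vev (optr p.2 y).

Lemma cform_linear x : linear (cform x : V -> C^o).
Proof.
move=> a u v; rewrite /cform scaler_sumr -big_split; apply: eq_bigr => p _ /=.
by rewrite optr_linear vevD vevZ mulrDr mulrCA.
Qed.

HB.instance Definition _ x := GRing.isLinear.Build C V C^o _ (cform x)
  (cform_linear x).

Lemma cformDr x u v : cform x (u + v) = cform x u + cform x v.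
Proof. exact: linearD. Qed.
Lemma cformBr x u v : cform x (u - v) = cform x u - cform x v.
Proof. exact: linearB. Qed.
Lemma cformZr x a u : cform x (a *: u) = a * cform x u.
Proof. exact: linearZ. Qed.
Lemma cformr0 x : cform x 0 = 0.
Proof. exact: linear0. Qed.
Lemma cform_sumr x I r (p : pred I) f :
  cform x (\sum_(i <- r | p i) f i) = \sum_(i <- r | p i) cform x (f i).
Proof. exact: linear_sum. Qed.

Lemma cform_op x q : cform x (op q vac) = vev (optr q x).
Proof.
rewrite /cform; case: cid => s /= ->.
have -> : vev (optr q (\sum_(p <- s) p.1 *: op p.2 vac)) = \sum_(p <- s) p.1 * vev
  (optr q (op p.2 vac)).
  elim: s => [|p s IH]; first by rewrite !big_nil optr0 vev0.
  by rewrite !big_cons optrD vevD optrZ vevZ IH.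
by apply: eq_bigr => p _; rewrite vev_optr_sym.
Qed.

Lemma cform_sym x y : cform x y = cform y x.
Proof.
have [s ->] := word_span y; rewrite cform_sumr.
have [t ->] := word_span x; rewrite cform_sumr.
under eq_bigr do rewrite cformZr cform_op.
under [RHS]eq_bigr do rewrite cformZr cform_op.
have H (f : C * seq (bool * int) -> V) w r :
    vev (optr w (\sum_(p <- r) p.1 *: f p)) = \sum_(p <- r) p.1 * vev (optr w (f p)).
  elim: r => [|p r IH]; first by rewrite !big_nil optr0 vev0.
  by rewrite !big_cons optrD vevD optrZ vevZ IH.
under eq_bigr do rewrite H mulr_sumr.
under [RHS]eq_bigr do rewrite H mulr_sumr.
rewrite exchange_big; apply: eq_bigr => p _; apply: eq_bigr => q _.
by rewrite mulrCA vev_optr_sym.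
Qed.

Lemma cformDl u v y : cform (u + v) y = cform u y + cform v y.
Proof. by rewrite !(cform_sym _ y) cformDr. Qed.
Lemma cformBl u v y : cform (u - v) y = cform u y - cform v y.
Proof. by rewrite !(cform_sym _ y) cformBr. Qed.
Lemma cformZl a u y : cform (a *: u) y = a * cform u y.
Proof. by rewrite !(cform_sym _ y) cformZr. Qed.
Lemma cform0l y : cform 0 y = 0.
Proof. by rewrite cform_sym cformr0. Qed.

Lemma cform_vac y : cform vac y = vev y.
Proof. by rewrite cform_sym -[vac]/(op [::] vac) cform_op. Qed.

Lemma cform_P e m x y : cform (P e m x) y = sgn e * cform x (P e (- m) y).
Proof.
have [s ->] := word_span y; rewrite (linear_sum (P _ _)) !cform_sumr mulr_sumr.
apply: eq_bigr => p _; rewrite linearZZ !cformZr mulrCA; congr (_ * _).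
rewrite cform_op -[P e (- m) _]/(op ((e, - m) :: p.2) vac) cform_op /= /transp /=.
by rewrite optrZ vevZ opprK mulrA sgnK mul1r.
Qed.

Lemma vev_L1 y : vev (L (-1) y) = 0.
Proof.
elim/(creation_ind (F := F)): y => [||e a v a0 h].
- by split=> [|k u v hu hv]; rewrite ?linear0 ?vev0 // linearP vevD vevZ hu hv
  mulr0 addr0.
- by rewrite sfL_vac // vev0.
- rewrite sfLP vevB vevZ vev_creation.
  have -> : -1 - a%:Z = - a.+1%:Z by lia.
  by rewrite vev_creation mulr0 subrr.
Qed.

(** Below -1 only L(-2) vac is given; L(-3) vac, L(-4) vac, ... are obtained from it by commutators
    with L(-1), whose image has no vacuum part. *)
Lemma vev_L_vac (m : int) : vev (L m vac) = 0.
Proof.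
have [m1|m1] := lerP (-1) m; first by rewrite sfL_vac // vev0.
have -> : m = - (`|(m + 2)%R|%N.+2)%:Z by lia.
elim: `|(m + 2)%R|%N => [|k IH]; first by rewrite sfL2_vac (vev_creation F false 1).
have := sfLL F (-1) (- k.+2%:Z) vac; rewrite (sfL_vac F (m := -1)) // linear0 add0r.
rewrite central_coef_ne ?scale0r ?addr0; last by lia.
move/(congr1 vev); rewrite vev_L1 vevZ => /esym/eqP; rewrite mulf_eq0 intr_eq0.
rewrite (_ : -1 - - k.+2%:Z == 0 = false) /=; last by lia.
by rewrite (_ : -1 + - k.+2%:Z = - k.+3%:Z); [move/eqP | lia].
Qed.

Lemma vev_L (m : int) y : m <= 1 -> vev (L m y) = 0.
Proof.
move=> m1; elim/(creation_ind (F := F)): y => [||e a v a0 h].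
- by split=> [|k u v hu hv]; rewrite ?linear0 ?vev0 // linearP vevD vevZ hu hv
  mulr0 addr0.
- exact: vev_L_vac.
- rewrite sfLP vevB vevZ vev_creation.
  have -> : m - a%:Z = - `|m - a%:Z|%N%:Z by lia.
  by rewrite vev_creation mulr0 subrr.
Qed.

(** The induction on x starts from L(m) vac = 0, which is available for m >= -1; the remaining m
    follow by symmetry of the form. *)
Lemma cform_L_le (m : int) x y : -1 <= m -> cform (L m x) y = cform x (L (- m) y).
Proof.
move=> m1; elim/(creation_ind (F := F)): x y => [|y|e a v a0 h y].
- split=> [y|k u v hu hv y]; first by rewrite linear0 !cform0l.
  by rewrite linearP !cformDl !cformZl hu hv.
- by rewrite sfL_vac // cform0l cform_vac vev_L //; lia.
- rewrite sfLP cformBl cformZl !cform_P h (sfLP F (- m)) cformBr cformZr mulrBr.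
  have -> : - (m - a%:Z) = - m - - a%:Z by lia.
  rewrite !rmorphN /=; ring.
Qed.

Lemma cform_L (m : int) x y : cform (L m x) y = cform x (L (- m) y).
Proof.
have [m1|m1] := lerP (-1) m; first exact: cform_L_le.
by rewrite cform_sym [RHS]cform_sym cform_L_le ?opprK //; lia.
Qed.

Lemma vev_Q y : vev (Q y) = 0.
Proof.
elim/(creation_ind (F := F)): y => [||[] a v a0 h].
- by split=> [|k u v hu hv]; rewrite ?linear0 ?vev0 // linearP vevD vevZ hu hv
  mulr0 addr0.
- by rewrite sfQ_vac vev0.
- by rewrite sfQP_true vevD vevZ !vev_creation mulr0 addr0.
- by rewrite sfQP_false vev_creation.
Qed.

(** Because the two types have opposite signs [sgn], the terms in phi^- that Q produces on either
    side cancel. *)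
Lemma cform_Q x y : cform (Q x) y = cform x (Q y).
Proof.
elim/(creation_ind (F := F)): x y => [|y|[] a v a0 h y].
- split=> [y|k u v hu hv y]; first by rewrite linear0 !cform0l.
  by rewrite linearP !cformDl !cformZl hu hv.
- by rewrite sfQ_vac cform0l cform_vac vev_Q.
- rewrite sfQP_true cformDl cformZl !cform_P h /sgn !mul1r sfQP_true cformDr cformZr.
  by rewrite mulN1r mulrN addrK.
- by rewrite sfQP_false !cform_P h sfQP_false.
Qed.

End ContravariantForm.

(** * Singular vectors *)

Section DegreeFiltration.
Context {C : numFieldType} {V : lmodType C} (F : symplecticFermion V).
Local Notation P := (sfP F).
Local Notation L := (sfL F).
Local Notation Q := (sfQ F).
Local Notation vac := (sfvac F).
Local Notation vev := (vev F).
Local Notation cform := (cform F).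
Local Notation weight := (weight F).

(* Spanned by the products of at least r creation operators applied to vac. *)
Fixpoint deg_ge (r : nat) (x : V) : Prop :=
  if r is r'.+1 then
    vev x = 0 /\ forall e a, (0 < a)%N -> deg_ge r' (P e a%:Z x)
  else True.

Arguments deg_ge : simpl never.

Lemma deg_ge_subspace r : subspace (deg_ge r).
Proof.
elim: r => [|r IH]; split=> //=.
  by split=> [|e a a0]; [rewrite vev0 | rewrite linear0; case: IH].
move=> k u v [u0 hu] [v0 hv]; split=> [|e a a0].
  by rewrite vevD vevZ u0 v0 mulr0 addr0.
by rewrite linearP; case: IH => _; apply; [exact: hu | exact: hv].
Qed.

Lemma deg_geW r x : deg_ge r.+1 x -> deg_ge r x.
Proof. by elim: r x => // r IH x [x0 hx]; split=> // e a a0; apply: IH;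
  exact: hx. Qed.

Lemma deg_ge_annihil r e a x : (0 < a)%N -> deg_ge r x -> deg_ge r.-1 (P e a%:Z x).
Proof. by case: r => // r a0 [_]; apply. Qed.

Lemma deg_ge_creation r e a x : (0 < a)%N ->
  deg_ge r x -> deg_ge r.+1 (P e (- a%:Z) x).
Proof.
move=> a0; elim: r x => [|r IH] x hx; first by split=> //; exact: vev_creation.
split=> [|e' b b0]; first exact: vev_creation.
rewrite sfPP; apply: subspaceB; first exact: deg_ge_subspace.
  by apply: subspaceZ => //; exact: deg_ge_subspace.
by apply: IH; case: hx => _; apply.
Qed.

Lemma deg_ge_Q r x : deg_ge r x -> deg_ge r (Q x).
Proof.
elim: r x => // r IH x [_ hx]; split=> [|[] a a0]; first exact: vev_Q.
  have -> : P true a%:Z (Q x) = Q (P true a%:Z x) - 2%:R *: P false a%:Z x.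
    by rewrite sfQP_true addrK.
  apply: subspaceB; [exact: deg_ge_subspace | by apply: IH; exact: hx|].
  by apply: subspaceZ; [exact: deg_ge_subspace | exact: hx].
by rewrite -sfQP_false; apply: IH; exact: hx.
Qed.

Lemma deg_ge_L0 r x : deg_ge r x -> deg_ge r (L 0 x).
Proof.
elim: r x => // r IH x [_ hx]; split=> [|e a a0]; first exact: vev_L.
have -> : P e a%:Z (L 0 x) = L 0 (P e a%:Z x) + a%:R *: P e a%:Z x.
  by rewrite sfLP add0r subrK.
apply: subspaceD; [exact: deg_ge_subspace | by apply: IH; exact: hx|].
by apply: subspaceZ; [exact: deg_ge_subspace | exact: hx].
Qed.

(** [sugawaraP] leaves the cutoff unspecified; on weight g the terms with b > g vanish, as they
    would lead to negative weight. *)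
Lemma sugawara_weight N (m : nat) g x : weight g x -> (g < N)%N ->
  L m%:Z x = sugawara F N m x.
Proof.
move=> w gN; have [N0 H] := sugawaraP F m x.
rewrite (H (maxn N N0)) ?leq_maxr // /sugawara; congr (_ + _).
rewrite (@big_cat_nat _ _ _ N) ?leq_maxl //=; last by lia.
rewrite [X in _ + X]big_nat [X in _ + X]big1 ?addr0 // => b b0.
have z e : P e (b + m)%N x = 0 by apply: (annihil_eq0 _ _ w); lia.
by rewrite !z !(linear0 (P _ _)) subr0.
Qed.

(** For a homogeneous vector, induction on the weight shows that all annihilation operators kill it.
    Then so does L(0) in normally ordered form, the vector is a multiple of the vacuum, and [vev]
    shows that the multiple is 0. *)
Lemma deg_ge_all_eq0 x : (forall r, deg_ge r x) -> x = 0.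
Proof.
have hom g y : weight g y -> (forall r, deg_ge r y) -> y = 0.
  have [n] := ubnP g; elim: n g y => // n IH g y gn w hy.
  have d0 e a : (0 < a)%N -> P e a%:Z y = 0.
    move=> a0; have [ag|ga] := leqP a g; last exact: annihil_eq0 w.
    apply: (IH (g - a)%N); first by lia.
      exact: weight_annihil.
    by move=> r; case: (hy r.+1) => _; apply.
  have : L 0 y = 0.
    rewrite (@sugawara_weight g.+1 0 g) // /sugawara [X in _ + X]big_geq // addr0.
    by rewrite big_nat big1 // => b b0; rewrite !d0 ?(linear0 (P _ _)) ?subr0 //; lia.
  move=> L0; have /weight0P[c yc] : weight 0 y by rewrite /weight L0 scale0r.
  by case: (hy 1%N) => + _; rewrite yc vevZ vev_vac mulr1 => ->; rewrite scale0r.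
move=> hx; apply: contrapT => x0.
have [] := @homogeneous_in _ _ F (fun x => forall r, deg_ge r x) x.
- split=> [r|k u v hu hv r]; first by case: (deg_ge_subspace r).
  by case: (deg_ge_subspace r) => _; apply.
- by move=> y hy r; exact: deg_ge_L0.
- by [].
- by [].
by move=> g [y [hy y0 w]]; apply: y0; exact: hom w hy.
Qed.

(** By adjointness the radical is stable under all modes, and [vev] vanishes on it, so it lies in
    every [deg_ge r]. *)
Lemma cform_nondeg x : (forall y, cform x y = 0) -> x = 0.
Proof.
move=> hx; apply: deg_ge_all_eq0 => r.
elim: r x hx => // r IH x hx; split; first by rewrite -cform_vac cform_sym.
by move=> e a a0; apply: IH => y; rewrite cform_P hx mulr0.
Qed.

(* For an element of degree >= r, "modulo degree > r" after applying k
   annihilation operators means "in degree >= r + 1 - k": the second condition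
   says that d(z) d'(z) kills the part of degree r of x, the third that its modes
   are at most M. *)
Definition null_quadratic (r M : nat) (x : V) : Prop :=
  [/\ deg_ge r x,
      (forall e e' k,
         deg_ge r.-1 (\sum_(1 <= a < k) P e a (P e' (k - a)%N x)))
    & (forall e a, (M < a)%N -> deg_ge r (P e a%:Z x))].

Lemma subspace_big_split (S : V -> Prop) (f : nat -> V) k i :
  subspace S -> (1 <= i < k)%N -> S (\sum_(1 <= a < k) f a) ->
  (forall a, (1 <= a < k)%N -> a != i -> S (f a)) -> S (f i).
Proof.
move=> hS ik hs hf.
have : S (\sum_(1 <= a < k) f a - \sum_(1 <= a < k | a != i) f a).
  apply: subspaceB => //; rewrite big_seq_cond; apply: subspace_sum => // a.
  by rewrite mem_index_iota => /andP[]; exact: hf.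
by rewrite (bigD1_seq i) ?iota_uniq ?mem_index_iota //= addrK.
Qed.

(** In the quadratic relation for k = 2 M every term except [P e' M (P e M x)] contains a mode above
    M and is negligible. So a second mode M acts trivially, and the bound drops to M - 1. *)
Lemma null_quadratic_annihil r M e x : (0 < M)%N -> null_quadratic r.+1 M x ->
  null_quadratic r M.-1 (P e M%:Z x).
Proof.
move=> M0 [hx hs hM]; split; first exact: (deg_ge_annihil e M0 hx).
- move=> e1 e2 k.
  have -> : \sum_(1 <= a < k) P e1 a (P e2 (k - a)%N (P e M%:Z x)) =
      P e M%:Z (\sum_(1 <= a < k) P e1 a (P e2 (k - a)%N x)).
    rewrite linear_sum; apply: eq_big_nat => a a1.
    rewrite [P e2 _ (P e _ _)]PP_anti; last by lia.
    by rewrite linearN [P e1 _ (P e _ _)]PP_anti ?opprK //; lia.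
  exact: deg_ge_annihil.
- move=> e' a; rewrite leq_eqVlt => /orP[/eqP Ma|Ma]; last first.
    rewrite PP_anti; last by lia.
    apply: subspaceN; first exact: deg_ge_subspace.
    by apply: (@deg_ge_annihil r.+1 e M) => //; apply: hM; lia.
  have -> : a = M by lia.
  have := @subspace_big_split _ (fun a => P e' a (P e (M.*2 - a)%N x)) M.*2 M
    (deg_ge_subspace r).
  rewrite -addnn addnK; apply.
  - lia.
  - exact: (hs e' e (M + M)%N).
  - move=> b b1 bM.
    have [bl|bl] := ltnP b M.
      by apply: (@deg_ge_annihil r.+1); [lia | apply: hM; lia].
    rewrite PP_anti; last by lia.
    apply: subspaceN; first exact: deg_ge_subspace.
    by apply: (@deg_ge_annihil r.+1); [lia | apply: hM; lia].
Qed.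

Lemma null_quadratic_Q r M x : null_quadratic r M x -> null_quadratic r M (Q x).
Proof.
move=> [hx hs hM].
have PQ e a y : P e a (Q y) = Q (P e a y) - (if e then 2%:R else 0) *: P false a y.
  case: e; first by rewrite sfQP_true addrK.
  by rewrite sfQP_false scale0r subr0.
split; first exact: deg_ge_Q.
- move=> e e' k; have hG := deg_ge_subspace r.-1.
  have -> : \sum_(1 <= a < k) P e a (P e' (k - a)%N (Q x)) =
     Q (\sum_(1 <= a < k) P e a (P e' (k - a)%N x))
     - (if e then 2%:R else 0) *: (\sum_(1 <= a < k) P false a (P e' (k - a)%N x))
     - (if e' then 2%:R else 0) *: (\sum_(1 <= a < k) P e a (P false (k - a)%N x)).
    rewrite linear_sum !scaler_sumr -!sumrB; apply: eq_bigr => a _.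
    by rewrite PQ (linearB (P _ _)) (linearZZ (P _ _)) PQ.
  apply: subspaceB => //; last by apply: subspaceZ.
  by apply: subspaceB => //; [exact: deg_ge_Q | exact: subspaceZ].
- move=> e a aM; rewrite PQ; apply: subspaceB; [exact: deg_ge_subspace| |].
    by apply: deg_ge_Q; auto.
  by apply: subspaceZ; [exact: deg_ge_subspace | auto].
Qed.

Lemma top_mode r M x : null_quadratic r.+1 M x -> ~ deg_ge r.+2 x ->
  exists e a, [/\ (0 < a <= M)%N, ~ deg_ge r.+1 (P e a%:Z x)
    & null_quadratic r.+1 a x].
Proof.
move=> [hx hs hM] hx2.
pose p a := `[< (0 < a)%N /\ exists e, ~ deg_ge r.+1 (P e a%:Z x) >].
have ex : exists a, p a.
  apply: contrapT => h; apply: hx2; split=> [|e a a0]; first by case: hx.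
  apply: contrapT => hn; apply: h; exists a; apply/asboolP; split=> //; by exists e.
have bnd a : p a -> (a <= M)%N.
  move=> /asboolP[_ [e he]]; rewrite leqNgt; apply/negP => Ma; apply: he.
  exact: hM.
case: (ex_maxnP ex bnd) => a pa amax.
have aM := bnd _ pa; move/asboolP: pa => [a0 [e he]].
exists e, a; split; rewrite ?a0 //; split=> // e' b ab.
apply: contrapT => hb.
have /amax : p b by apply/asboolP; split; [lia | exists e'].
lia.
Qed.

(** Successive top modes decrease strictly, so the weight is at most M + (M - 1) + ... + (M - r +
    1); the inequality is twice this, written without subtraction. *)
Lemma null_quadratic_bound r M g x : null_quadratic r M x -> ~ deg_ge r.+1 x ->
  weight g x -> (r <= M)%N /\ (g.*2 + r * r <= (r * M).*2 + r)%N.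
Proof.
elim: r M g x => [|r IH] M g x hx hx1 w.
  split=> //; suff -> : g = 0%N by lia.
  apply: contrapT => g0; apply: hx1; split=> //.
  have := vev_L F x (m := 0) isT; rewrite w vevZ => /eqP.
  by rewrite mulf_eq0 pnatr_eq0 => /orP[/eqP|/eqP].
have [e [a [/andP[a0 aM] ha hxa]]] := top_mode hx hx1.
have ag : (a <= g)%N.
  rewrite leqNgt; apply/negP => ga; apply: ha; rewrite (annihil_eq0 _ ga w).
  by case: (deg_ge_subspace r.+1).
have [ra gr] := IH _ _ _ (null_quadratic_annihil e a0 hxa) ha (weight_annihil (F :=
  F) e ag w).
split; first by lia.
nia.
Qed.

Lemma quad_same e k v : \sum_(1 <= a < k) P e a (P e (k - a)%N v) = 0.
Proof.
suff h : \sum_(1 <= a < k) P e a (P e (k - a)%N v) = - \sum_(1 <= a < k) P e a (P e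
  (k - a)%N v).
  have /eqP := h; rewrite -subr_eq0 opprK -mulr2n -scaler_nat scaler_eq0 pnatr_eq0.
  by move/eqP.
rewrite {1}big_nat_rev -sumrN; apply: eq_big_nat => a ak /=.
rewrite PP_same; have -> : (k - (1 + k - a.+1) = a)%N by lia.
by have -> : (1 + k - a.+1 = k - a)%N by lia.
Qed.

Lemma quad_swap e e' k v : \sum_(1 <= a < k) P e a (P e' (k - a)%N v) =
  - \sum_(1 <= a < k) P e' a (P e (k - a)%N v).
Proof.
rewrite [in RHS]big_nat_rev -sumrN; apply: eq_big_nat => a ak /=.
rewrite PP_anti; last by lia.
have -> : (k - (1 + k - a.+1) = a)%N by lia.
by have -> : (1 + k - a.+1 = k - a)%N by lia.
Qed.

(** These are the modes of d^e(z) d^-(z) d^+(z), d being the annihilation part: one of the last two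
    factors has type e, and d^e(z) squares to 0. *)
Lemma cubic_zero e k v :
  \sum_(1 <= a < k) P e a (\sum_(1 <= b < k - a) P false b (P true (k - a - b)%N
    v)) = 0.
Proof.
suff H : \sum_(1 <= a < k) P e a (\sum_(1 <= b < k - a) P (~~ e) b (P e (k - a -
  b)%N v)) = 0.
  case: e H => // H; rewrite -[RHS]oppr0 -[in RHS]H -sumrN; apply: eq_bigr => a _.
  by rewrite quad_swap linearN.
have E a : (1 <= a < k)%N -> P e a (\sum_(1 <= b < k - a) P (~~ e) b (P e (k - a -
  b)%N v)) =
   - \sum_(1 <= b < k | (a + b < k)%N) P (~~ e) b (P e a (P e (k - b - a)%N v)).
  move=> ak; rewrite linear_sum -sumrN.
  rewrite [RHS](@big_cat_nat _ _ _ (k - a)) /=; try lia.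
  rewrite [X in _ + X]big_nat_cond [X in _ + X]big_pred0 ?addr0; last by move=> b;
    lia.
  rewrite big_nat [RHS]big_nat_cond; apply: eq_big => b; first by lia.
  move=> bk; rewrite PP_anti; last by lia.
  by congr (- P _ _ (P _ _ (P _ _ _))); lia.
rewrite (eq_big_nat _ _ E) sumrN (exchange_big_dep xpredT) //=.
rewrite big_nat big1 ?oppr0 // => b bk.
rewrite -linear_sum.
rewrite [X in P _ _ X](_ : _ = 0) ?linear0 //.
rewrite -[RHS](quad_same e (k - b) v) [LHS](@big_cat_nat _ _ _ (k - b)) /=; try lia.
rewrite [X in _ + X]big_nat_cond [X in _ + X]big_pred0 ?addr0; last by move=> a; lia.
by rewrite big_nat_cond [RHS]big_nat; apply: eq_bigl => a; lia.
Qed.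

Definition singular (v : V) : Prop := forall m : nat, (0 < m)%N -> L m%:Z v = 0.

(** In L(k) v = 0 the pairs of annihilation operators equal minus a sum of creation times
    annihilation operators, which does not lower the degree, whereas a pair of annihilation
    operators could lower it by two. *)
Lemma singular_quadratic r e e' k v : singular v -> deg_ge r v ->
  deg_ge r.-1 (\sum_(1 <= a < k) P e a (P e' (k - a)%N v)).
Proof.
move=> sv hv; have hG := deg_ge_subspace r.-1.
have [k1|k1] := leqP k 1; first by rewrite big_geq //; case: hG.
suff H : deg_ge r.-1 (\sum_(1 <= a < k) P false a (P true (k - a)%N v)).
  case: e e' => [] [] //; rewrite ?quad_same; try by case: hG.
  by rewrite quad_swap; exact: subspaceN.
have [N0 HN] := sugawaraP F k v.
have := HN N0 (leqnn _); rewrite sv 1?ltnW // /sugawara addrC => /esym/eqP.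
rewrite addr_eq0 => /eqP ->; apply: subspaceN => //.
rewrite big_nat; apply: subspace_sum => // b b0.
have H e1 e2 : deg_ge r.-1 (P e1 (- b%:Z) (P e2 (b + k)%N v)).
  apply: deg_geW; apply: deg_ge_creation; first by lia.
  by apply: deg_ge_annihil => //; lia.
exact: subspaceB.
Qed.

(* Since phi^e(z) :phi^-(z) phi^+(z): = 0, a singular vector satisfies a
   second-order equation of Belavin-Polyakov-Zamolodchikov type, whose leading
   coefficient determines the weight. *)
Lemma singular_weight n M h e v : singular v -> weight h v -> deg_ge n.+1 v ->
  (0 < M <= h)%N -> (forall e' a, (M < a)%N -> deg_ge n.+1 (P e' a%:Z v)) ->
  ~ deg_ge n.+1 (P e M%:Z v) -> h.*2 = (M * M.+1)%N.
Proof.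
move=> sv w hv /andP[M0 Mh] hM heM.
(* On weights at most h, L(m) splits into creation-annihilation terms [S m] and pairs of
   annihilation operators [D m]. *)
pose S (m : nat) x := \sum_(1 <= b < h.+1)
  (P false (- b%:Z) (P true (b + m)%N x) - P true (- b%:Z) (P false (b + m)%N x)).
pose D (m : nat) x := \sum_(1 <= a < m) P false a (P true (m - a)%N x).
have LE m g x : weight g x -> (g <= h)%N -> L m%:Z x = S m x + D m x.
  by move=> wx gh; rewrite (sugawara_weight _ wx (N := h.+1)).
have PS a : (1 <= a < M)%N -> P e a%:Z (S (M - a)%N v) =
    S (M - a)%N (P e a%:Z v) + a%:R *: P e M%:Z v.
  move=> aM.
  have E1 := LE (M - a)%N h v w (leqnn _).
  have E2 := LE (M - a)%N _ _ (weight_annihil (F :=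
    F) e (ltnW (leq_trans (proj2 (andP aM)) Mh)) w) (leq_subr _ _).
  have -> : S (M - a)%N v = L (M - a)%N v - D (M - a)%N v by rewrite E1 addrK.
  have -> : S (M - a)%N (P e a%:Z v) = L (M - a)%N (P e a%:Z v) - D (M - a)%N (P e
    a%:Z v).
    by rewrite E2 addrK.
  rewrite sfLP linearB /D.
  have -> : ((M - a)%N%:Z + a%:Z) = M%:Z by lia.
  rewrite addrAC subrK; congr (_ - _).
  rewrite linear_sum; apply: eq_big_nat => b bM.
  rewrite [P e _ (P false _ _)]PP_anti; last by lia.
  by rewrite [P e _ (P true _ _)]PP_anti ?(linearN (P _ _)) ?opprK //; lia.
(* As v is singular, [S] equals [- D] on it, and the sum becomes a cubic expression that vanishes
   identically. *)
have X0 : \sum_(1 <= a < M) P e a%:Z (S (M - a)%N v) = 0.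
  transitivity (- \sum_(1 <= a < M) P e a%:Z (D (M - a)%N v)); last first.
    by rewrite cubic_zero oppr0.
  rewrite -sumrN; apply: eq_big_nat => a aM.
  rewrite -linearN; congr (P _ _ _); apply/eqP; rewrite -addr_eq0.
  by rewrite -/(D _ _) -(LE _ h) // sv //; lia.
have hG := deg_ge_subspace n.+1; have hG' := deg_ge_subspace n.
(* For fixed b, the modes a <= M form a full quadratic sum of total b + M, up to terms with a > M,
   negligible by [hM]; [singular_quadratic] applies to the full sum. *)
have XS : deg_ge n.+1 (\sum_(1 <= a < M) S (M - a)%N (P e a%:Z v) + S 0%N (P e M%:Z
  v)).
  rewrite /S exchange_big -big_split /= big_nat; apply: (subspace_sum _ hG) => b bh.
  have W e' : deg_ge n (\sum_(1 <= a < M) P e' (b + (M - a))%N (P e a%:Z v)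
                        + P e' (b + 0)%N (P e M%:Z v)).
    have := singular_quadratic e e' (b + M) sv hv.
    rewrite quad_swap => /(subspaceN hG'); rewrite opprK big_nat_rev /=.
    rewrite (@big_cat_nat _ _ _ M.+1) /=; try lia.
    rewrite big_nat_recr //=.
    move=> H.
    have -> : \sum_(1 <= a < M) P e' (b + (M - a))%N (P e a%:Z v) = \sum_(1 <= i <
      M) P e' (1 + (b + M) - i.+1)%N (P e (b + M - (1 + (b + M) - i.+1))%N v).
      apply: eq_big_nat => a aM.
      by congr (P _ _ (P _ _ _)); lia.
    have -> : P e' (b + 0)%N (P e M%:Z v) = P e' (1 + (b + M) - M.+1)%N (P e (b + M
      - (1 + (b + M) - M.+1))%N v).
      by congr (P _ _ (P _ _ _)); lia.
    rewrite -[X in deg_ge n X](addrK (\sum_(M.+1 <= i < b + M) P e' (1 + (b + M) -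
      i.+1)%N (P e (b + M - (1 + (b + M) - i.+1))%N v))).
    apply: subspaceB => //.
    rewrite big_nat; apply: subspace_sum => // a aM.
    apply: (@deg_ge_annihil n.+1); first by lia.
    by apply: hM; lia.
  rewrite sumrB addrACA -opprD -!linear_sum -!linearD.
  by apply: subspaceB => //; apply: deg_ge_creation => //; lia.
have := X0; rewrite (eq_big_nat _ _ PS) big_split /= -scaler_suml => X0'.
have L0 : S 0%N (P e M%:Z v) = (h - M)%:R *: P e M%:Z v.
  have wM := weight_annihil (F := F) e Mh w.
  rewrite -wM (LE 0%N _ _ wM) ?leq_subr // /D big_geq // addr0 //.
(* Comparing [X0] and [XS] leaves a scalar times [P e M v]. This vector is not in degree n + 1, so
   the scalar is 0 and h = M + (1 + ... + (M - 1)). *)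
have : deg_ge n.+1 (((h - M)%:R - \sum_(1 <= i < M) i%:R) *: P e M%:Z v).
  move: XS; rewrite L0 => XS.
  rewrite scalerBl -[X in deg_ge _ X]add0r -{1}X0' -/(_ + _) addrACA subrr addr0.
  exact: XS.
have [E _|ne] := eqVneq ((h - M)%:R - \sum_(1 <= i < M) i%:R : C) 0; last first.
  by move=> hc; case: heM; exact: subspaceZ_inv hc.
have {}E : (h - M)%N = (\sum_(1 <= i < M) i)%N.
  by apply/eqP; rewrite -(eqr_nat C) natr_sum -subr_eq0 E.
have G k : ((\sum_(1 <= i < k.+1) i).*2 = k * k.+1)%N.
  elim: k => [|k IH]; first by rewrite big_geq.
  by rewrite big_nat_recr //= doubleD IH; lia.
case: M M0 Mh E {hM heM PS X0 XS X0' L0} => // M _ Mh E.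
have := G M; rewrite -E; lia.
Qed.

Lemma singular_null_quadratic n h v : singular v -> weight h v ->
  deg_ge n v -> ~ deg_ge n.+1 v ->
  h.*2 = (n * n.+1)%N /\ null_quadratic n n v.
Proof.
move=> sv w hn hn1.
have sq e e' k := singular_quadratic e e' k sv hn.
case: n hn hn1 sq => [|n] hn hn1 sq.
  have nq : null_quadratic 0 0 v by split.
  by have [_] := null_quadratic_bound nq hn1 w; split=> //; lia.
have nq : null_quadratic n.+1 h v.
  split=> // e a ha; rewrite (annihil_eq0 e ha w).
  by case: (deg_ge_subspace n.+1).
have [e [M [MM heM [h1 h2 hM]]]] := top_mode nq hn1.
have hh := singular_weight sv w hn MM hM heM.
have [b1 b2] := null_quadratic_bound (And3 h1 h2 hM) hn1 w.
(* With 2 h = M (M + 1) the bound [b2] becomes (M - n - 1) (M - n) <= 0, while [b1] says M >= n +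
   1. *)
have nM : M = n.+1 by nia.
by rewrite nM in hh hM *; split=> //; split.
Qed.

(** For s of length n, the functional x -> vev(phi(1) ... phi(n) x), the head of s being the type of
    phi(n). *)
Fixpoint chain (s : seq bool) (x : V) : C :=
  if s is e :: s' then chain s' (P e (size s)%:Z x) else vev x.

Arguments chain : simpl never.

Lemma chain_cons e s x : chain (e :: s) x = chain s (P e (size s).+1 x).
Proof. by []. Qed.

Lemma chain_linear s : linear (chain s : V -> C^o).
Proof.
elim: s => [|e s IH] k u v; first exact: vev_linear.
by rewrite !chain_cons linearP IH.
Qed.

Lemma chainB s u v : chain s (u - v) = chain s u - chain s v.
Proof. by rewrite -scaleN1r addrC chain_linear scaleN1r addrC. Qed.

Lemma chainZ s a u : chain s (a *: u) = a * chain s u.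
Proof. exact: (scalable_linear (@chain_linear s)). Qed.

Lemma chain_deg_ge s x : deg_ge (size s).+1 x -> chain s x = 0.
Proof. by elim: s x => [|e s IH] x [x0 hx] //=; apply: IH; exact: hx. Qed.

Lemma null_quadratic_le r M x : null_quadratic r M x -> ~ deg_ge r.+1 x -> (r <= M)%N.
Proof.
elim: r M x => // r IH M x hx hx1.
have [e [a [/andP[a0 aM] ha hxa]]] := top_mode hx hx1.
have := IH _ _ (null_quadratic_annihil e a0 hxa) ha; lia.
Qed.

Lemma chain_exists r x : null_quadratic r r x -> ~ deg_ge r.+1 x ->
  exists2 s, size s = r & chain s x <> 0.
Proof.
elim: r x => [|r IH] x hx hx1.
  by exists [::] => // x0; apply: hx1; split.
have [e [a [/andP[a0 ar] ha hxa]]] := top_mode hx hx1.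
have ra := null_quadratic_le hxa hx1.
have ea : a = r.+1 by lia.
rewrite ea in ha hxa.
have [s sr cs] := IH _ (null_quadratic_annihil e (ltn0Sn r) hxa) ha.
by exists (e :: s); rewrite ?chain_cons /= sr.
Qed.

(** With r the length of s, the quadratic relation of total 2 r + 3 keeps only the two terms in the
    modes r + 1 and r + 2; any other term contains a mode above r + 2. *)
Lemma chain_swap e e' s x : null_quadratic (size s).+2 (size s).+2 x ->
  chain [:: e, e' & s] x = chain [:: e', e & s] x.
Proof.
set r := size s => -[hx hs hM]; rewrite !chain_cons /= -/r.
apply/eqP; rewrite -subr_eq0 -chainB; apply/eqP/chain_deg_ge; rewrite -/r.
have hG := deg_ge_subspace r.+1.
have hd a e1 e2 (b : nat) : (0 < b)%N -> (r.+2 < a)%N -> deg_ge r.+1 (P e1 b (P e2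
  a x)).
  by move=> b0 ar; apply: (@deg_ge_annihil r.+2) => //; exact: hM.
have := hs e' e (r.+1 + r.+2)%N.
rewrite (@big_cat_nat _ _ _ r.+1) /=; try lia.
rewrite (@big_cat_nat _ _ _ r.+3 r.+1) /=; try lia.
rewrite [\sum_(r.+1 <= i < r.+3) _]big_nat_recr //= [\sum_(r.+1 <= i < r.+2)
  _]big_nat1.
have -> : (r.+1 + r.+2 - r.+1 = r.+2)%N by lia.
have -> : (r.+1 + r.+2 - r.+2 = r.+1)%N by lia.
rewrite [P e' r.+2 (P e _ _)]PP_anti; last by lia.
set A := \sum_(1 <= i < r.+1) _; set B := \sum_(r.+3 <= i < _) _.
have hA : deg_ge r.+1 A.
  rewrite /A big_nat; apply: (subspace_sum _ hG) => a ar; apply: hd; lia.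
have hB : deg_ge r.+1 B.
  rewrite /B big_nat; apply: (subspace_sum _ hG) => a ar.
  rewrite PP_anti; last by lia.
  by apply: subspaceN => //; apply: hd; lia.
move=> H.
have := subspaceB hG (subspaceB hG H hA) hB.
by rewrite [A + _]addrC addrK addrK.
Qed.

(** Exchanging neighbours by [chain_swap] shows that only the number of [true] matters: r + 1 values
    determine all chains. *)
Lemma chain_count r (s t : seq bool) x : null_quadratic r r x -> size s = r -> size
  t = r ->
  count_mem true s = count_mem true t -> chain s x = chain t x.
Proof.
elim: r s t x => [|r IH] [|e s] [|e' t] x // hx [sr] [tr] st.
have hP e0 := null_quadratic_annihil e0 (ltn0Sn r) hx.
have [ee|ee] := eqVneq e e'.
  rewrite !chain_cons sr tr ee; apply: IH => //; move: st; rewrite /= ee; lia.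
wlog: e e' s t sr tr st ee / e' = false.
  move=> H; case: e' ee st => ee st; last exact: H.
  by apply/esym/(H true e); rewrite 1?eq_sym //; case: e ee {st}.
move=> e'F; rewrite e'F in ee st *; have eT : e = true by case: e ee {st}.
rewrite eT in st * => {e e' e'F ee eT}.
have tt : true \in t by rewrite -has_pred1 has_count -/(count_mem true t);
  move: st => /=; lia.
have := perm_to_rem tt; set u := rem true t => tu.
have ut := perm_size tu; rewrite /= tr in ut.
have uc := permP tu (pred1 true); rewrite /= in uc.
case: r IH hx hP sr tr ut => [|r] IH hx hP sr tr ut //.
have ur : size u = r by case: ut.
transitivity (chain [:: false, true & u] x); last first.
  rewrite [LHS]chain_cons [RHS]chain_cons /= ur tr; apply: IH => //=;
    by rewrite ?ur ?uc.
rewrite chain_swap ?ur // [LHS]chain_cons [RHS]chain_cons /= ur sr.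
apply: IH => //=; rewrite ?ur //.
move: st => /=; lia.
Qed.

(** Q replaces each phi^+ of the chain in turn by phi^-, with factor -2, and all results agree by
    [chain_count]. If s has no [true], the truncated predecessor is harmless because the factor is
    0. *)
Lemma chain_Q r (s t : seq bool) x : null_quadratic r r x -> size s = r -> size t =
  r ->
  count_mem true t = (count_mem true s).-1 ->
  chain s (Q x) = - (2 * count_mem true s)%:R * chain t x.
Proof.
elim: r s t x => [|r IH] [|e s] t x // hx.
  by move=> _ _ _; rewrite /chain /= vev_Q muln0 oppr0 mul0r.
move=> [sr] tr ts.
have hP e0 := null_quadratic_annihil e0 (ltn0Sn r) hx.
have cs : (count_mem true s <= r)%N by rewrite -sr count_size.
pose t' := nseq (count_mem true s).-1 true ++ nseq (r - (count_mem true s).-1) false.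
have t'r : size t' = r by rewrite size_cat !size_nseq; lia.
have t'c : count_mem true t' = (count_mem true s).-1.
  by rewrite count_cat !count_nseq /= mul1n mul0n addn0.
have E (e0 : bool) : (e0 + (count_mem true s).-1 == count_mem true t)%N ||
  (count_mem true s == 0)%N ->
    chain s (Q (P e0 r.+1%:Z x)) = - (2 * count_mem true s)%:R * chain t x.
  move=> h; rewrite (IH _ t' _ (hP e0)) //.
  have [s0|s0] := eqVneq (count_mem true s) 0%N;
    first by rewrite s0 muln0 oppr0 !mul0r.
  congr (_ * _); rewrite -(chain_count hx (s := e0 :: t')) ?chain_cons /= ?t'r //.
  by rewrite t'c; move: h; rewrite (negbTE s0) orbF => /eqP <-; case: (e0).
case: e ts => ts; rewrite chain_cons sr /=.
- have -> : P true r.+1%:Z (Q x) = Q (P true r.+1%:Z x) - 2%:R *: P false r.+1%:Z x.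
    by rewrite sfQP_true addrK.
  rewrite chainB chainZ E; last by move: ts => /=; lia.
  have -> : chain s (P false r.+1%:Z x) = chain t x.
    rewrite -(chain_count hx (s := false :: s)) ?chain_cons /= ?sr //;
      by move: ts => /=; lia.
  by rewrite mulnDr natrD muln1; ring.
- by rewrite -sfQP_false E //; move: ts => /=; lia.
Qed.

(** By [chain_Q], k applications of Q trade the k entries [false] of s for [true], with nonzero
    factors. *)
Lemma chain_top n k v (s : seq bool) : null_quadratic n n v -> size s = n ->
  (count_mem true s + k = n)%N -> chain s v <> 0 ->
  chain (nseq n true) (iter k Q v) <> 0.
Proof.
elim: k v s => [|k IH] v s hv sn sk cs.
  rewrite addn0 in sk; rewrite /= -(chain_count hv sn) ?size_nseq //.
  by rewrite count_nseq mul1n.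
pose t := nseq (count_mem true s).+1 true ++ nseq k false.
have tn : size t = n by rewrite size_cat !size_nseq; lia.
have tc : count_mem true t = (count_mem true s).+1.
  by rewrite count_cat !count_nseq /= mul1n mul0n addn0.
rewrite iterSr; apply: (IH _ t) => //.
- exact: null_quadratic_Q.
- by rewrite tc; lia.
- rewrite (chain_Q hv tn sn) ?tc // => /eqP; rewrite mulf_eq0 oppr_eq0 pnatr_eq0.
  by case/orP => [|/eqP //]; lia.
Qed.

(** Through [chain_wtop] and the adjointness of Q, this says that a nonzero homogeneous singular
    vector is not orthogonal to all w_{n,k}. *)
Lemma singular_detect h v : singular v -> weight h v -> v <> 0 ->
  exists n k, [/\ (k <= n)%N, h.*2 = (n * n.+1)%N
    & chain (nseq n true) (iter k Q v) <> 0].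
Proof.
move=> sv w v0.
have ex : exists r, `[< ~ deg_ge r v >].
  apply: contrapT => hn; apply: v0; apply: deg_ge_all_eq0 => r.
  by apply: contrapT => hr; apply: hn; exists r; exact/asboolP.
case: (ex_minnP ex) => -[|n] /asboolP hn1 nmin; first by case: hn1.
have hn : deg_ge n v.
  by apply: contrapT => hn; have /nmin := introT (asboolP _) hn; rewrite ltnn.
have [hh nq] := singular_null_quadratic sv w hn hn1.
have [s sn cs] := chain_exists nq hn1.
have csn : (count_mem true s <= n)%N by rewrite -sn count_size.
exists n, (n - count_mem true s)%N; split=> //; first exact: leq_subr.
apply: chain_top cs => //; exact: subnKC.
Qed.

End DegreeFiltration.

(** * Decomposition of the Fock space *)

Section FiniteDuality.
Context {C : fieldType} {N : nat}.
Implicit Types U : 'rV[C]_N -> Prop.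

Lemma row_comb_in U m (A : 'M[C]_(m, N)) (D : 'rV[C]_m) : subspace U ->
  (forall i, U (row i A)) -> U (D *m A).
Proof.
move=> [U0 UL] UA; rewrite mulmx_sum_row; elim/big_rec: _ => // i u _ Uu.
exact: UL.
Qed.

(** A matrix of maximal rank among those with rows in U has row space U, and some column of its
    [cokermx] separates x. *)
Lemma separating_col U (x : 'rV[C]_N) : subspace U -> ~ U x ->
  exists c : 'cV[C]_N, (forall u, U u -> u *m c = 0) /\ x *m c <> 0.
Proof.
move=> US Ux.
pose p r := `[< exists A : 'M[C]_N, \rank A = r /\ forall i, U (row i A) >].
have ex : exists r, p r.
  exists 0%N; apply/asboolP; exists 0; rewrite mxrank0; split=> // i.
  by rewrite row0; case: US.
have bnd r : p r -> (r <= N)%N by move=> /asboolP[A [<- _]]; exact: rank_leq_row.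
case: (ex_maxnP ex bnd) => r /asboolP[A [rA UA]] rmax.
have UsubA u : U u -> (u <= A)%MS.
  move=> Uu; apply: contrapT => uA.
  pose B := <<col_mx A u>>%MS.
  have UB i : U (row i B).
    have /submxP[D ->] : (row i B <= col_mx A u)%MS.
      by rewrite (submx_trans (row_sub _ _)) // genmxE.
    apply: row_comb_in => // k; rewrite -[k]splitK; case: split => k' /=.
      by rewrite rowKu.
    by rewrite rowKd row_id.
  have /rmax : p (\rank B) by apply/asboolP; exists B.
  rewrite -rA genmxE leqNgt => /negP; apply.
  apply: rank_ltmx; rewrite /ltmx -addsmxE addsmxSl /=.
  by apply/negP; rewrite col_mx_sub => /andP[_ /uA].
have xA : x *m cokermx A != 0.
  apply/negP; rewrite -submxE => /submxP[D xD]; apply: Ux; rewrite xD.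
  exact: row_comb_in.
have [j xj] : exists j, (x *m cokermx A) 0 j != 0.
  apply/existsP; apply: contraR xA; rewrite negb_exists => /forallP h.
  by apply/eqP/rowP => j; rewrite [RHS]mxE; exact/eqP/negPn/h.
exists (col j (cokermx A)); split=> [u /UsubA|].
  by rewrite submxE colE mulmxA => /eqP ->; rewrite mul0mx.
by rewrite colE mulmxA -colE => /colP/(_ 0); rewrite !mxE => h; move: xj;
  rewrite mxE h eqxx.
Qed.

End FiniteDuality.

Section SingularVectors.
Context {C : numFieldType} {V : lmodType C} (F : symplecticFermion V).
Local Notation P := (sfP F).
Local Notation L := (sfL F).
Local Notation Q := (sfQ F).
Local Notation vac := (sfvac F).
Local Notation vev := (vev F).
Local Notation cform := (cform F).
Local Notation weight := (weight F).
Local Notation singular := (singular F).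
Local Notation chain := (chain F).

(** * The vectors w_{n,j} and their pairings *)

Fixpoint wtop (n : nat) : V :=
  if n is k.+1 then P true (- k.+1%:Z) (wtop k) else vac.

Fixpoint wbot (n : nat) : V :=
  if n is k.+1 then P false (- k.+1%:Z) (wbot k) else vac.

Definition wvec (n j : nat) : V := iter j Q (wtop n).

Definition hwt (n : nat) : nat := (n * n.+1)./2.

Lemma hwt_double n : (hwt n).*2 = (n * n.+1)%N.
Proof. by rewrite halfK oddM /= andbN subn0. Qed.

Lemma hwtS n : hwt n.+1 = (hwt n + n.+1)%N.
Proof. by have := hwt_double n; have := hwt_double n.+1; nia. Qed.

Lemma hwt_inj : injective hwt.
Proof. by move=> m n e; have := hwt_double n; rewrite -e hwt_double; nia. Qed.

Lemma PP_sq e m v : P e m (P e m v) = 0.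
Proof.
have /eqP := PP_same F e m m v; rewrite -subr_eq0 opprK -mulr2n -scaler_nat.
by rewrite scaler_eq0 pnatr_eq0 => /eqP.
Qed.

(** The modes phi^+ anticommute and square to 0: for -n <= m < 0 the mode already occurs in
    [wtop n], for m >= 0 it reaches the vacuum. *)
Lemma wtop_true_eq0 n (m : int) : - n%:Z <= m -> P true m (wtop n) = 0.
Proof.
elim: n m => [|n IH] m nm /=; first by rewrite sfP_vac //; lia.
rewrite PP_same; have [mn|mn] := lerP (- n%:Z) m;
  first by rewrite IH // linear0 oppr0.
have -> : m = - n.+1%:Z by lia.
by rewrite PP_sq oppr0.
Qed.

Lemma wtop_singular n : singular (wtop n).
Proof.
move=> m m0; elim: n => [|n IH] /=; first by rewrite sfL_vac //; lia.
by rewrite sfLP IH linear0 wtop_true_eq0 ?scaler0 ?subr0 //; lia.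
Qed.

Lemma wtop_weight n : weight (hwt n) (wtop n).
Proof.
elim: n => [|n IH]; first exact: weight_vac.
by rewrite hwtS; exact: weight_creation.
Qed.

Lemma sfQL (m : int) v : -1 <= m -> Q (L m v) = L m (Q v).
Proof.
move=> m1; elim/(creation_ind (F := F)): v => [||e a v a0 IH].
- by split=> [|k u v hu hv]; rewrite ?linear0 // !linearP hu hv.
- by rewrite sfQ_vac sfL_vac // !linear0.
- rewrite sfLP (linearB Q) (linearZZ Q); case: e.
    rewrite !sfQP_true (linearD (L m)) (linearZZ (L m)) !sfLP IH scalerDr scalerBr
      !scalerA.
    by rewrite [_ * 2%:R]mulrC opprD addrACA.
  by rewrite !sfQP_false sfLP IH.
Qed.

Lemma wvec_singular n j : singular (wvec n j).
Proof.
move=> m m0; elim: j => [|j IH] /=; first exact: wtop_singular.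
by rewrite -sfQL ?IH ?linear0 //; lia.
Qed.

Lemma wvec_weight n j : weight (hwt n) (wvec n j).
Proof.
elim: j => [|j IH]; first exact: wtop_weight.
by rewrite /weight /= -sfQL // IH linearZZ.
Qed.

Lemma chain_wtop n y : chain (nseq n true) y = cform (wtop n) y.
Proof.
elim: n y => [|n IH] y; first by rewrite cform_vac.
by rewrite chain_cons IH /= cform_P mul1r opprK size_nseq.
Qed.

Lemma cform_iterQ j x y : cform (iter j Q x) y = cform x (iter j Q y).
Proof. by elim: j y => //= j IH y; rewrite cform_Q IH -iterSr. Qed.

(** Leibniz rule, with two terms only because Q commutes with phi^-. For i = 0 the factor 2 i
    neutralises [i.-1]. *)
Lemma iterQ_true i m x : iter i Q (P true m x) =
  P true m (iter i Q x) + (2 * i)%:R *: P false m (iter i.-1 Q x).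
Proof.
elim: i => [|i IH]; first by rewrite muln0 scale0r addr0.
rewrite iterS IH linearD linearZZ sfQP_true sfQP_false -iterS -addrA; congr (_ + _).
case: i {IH} => [|i]; first by rewrite muln0 scale0r addr0.
by rewrite -iterS -scalerDl -natrD [(2 * i.+2)%N]mulnS.
Qed.

Lemma wvec_annihil e (m : nat) n i : (n < m)%N -> P e m (wvec n i) = 0.
Proof.
elim: n i => [|n IH] i nm.
  rewrite /wvec /=; suff -> : iter i Q vac = if i is 0 then vac else 0.
    by case: i; rewrite ?linear0 ?sfP_vac.
  by elim: i => //= -[|i] ->; rewrite ?linear0 ?sfQ_vac.
rewrite /wvec /= iterQ_true (linearD (P _ _)) (linearZZ (P _ _)).
rewrite [P e m (P true _ _)]PP_anti; last by lia.
rewrite [P e m (P false _ _)]PP_anti; last by lia.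
have H k : P e m (iter k Q (wtop n)) = 0 by apply: IH; lia.
by rewrite !H !(linear0 (P _ _)) !oppr0 scaler0 addr0.
Qed.

(** Only the term of [iterQ_true] in phi^-(-n) contracts with phi^+(n), so n and i go down together;
    at n = 0 only i = 0 survives. *)
Lemma chain_wvec n i : (chain (nseq n true) (wvec n i) != 0) = (i == n).
Proof.
elim: n i => [|n IH] i.
  rewrite /wvec /chain /=; case: i => [|i]; first by rewrite vev_vac oner_eq0.
  by rewrite iterS vev_Q eqxx.
rewrite chain_cons size_nseq {1}/wvec /= iterQ_true linearD linearZZ.
rewrite PP_same (wvec_annihil true i (ltnSn n)) linear0 oppr0 add0r.
rewrite sfPP (wvec_annihil true i.-1 (ltnSn n)) linear0 subr0.
rewrite pairing_true subrr eqxx !chainZ !mulf_eq0 !negb_or IH pnatr_eq0 muln_eq0.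
by case: i => [|i] //=; rewrite eqSS intr_eq0.
Qed.

Lemma cform_weight g g' x y : weight g x -> weight g' y -> g <> g' -> cform x y = 0.
Proof.
rewrite /weight => wx wy gg; have := cform_L F 0 x y.
rewrite oppr0 wx wy cformZl cformZr => /eqP; rewrite -subr_eq0 -mulrBl mulf_eq0.
by rewrite subr_eq0 eqr_nat => /orP[/eqP //|/eqP].
Qed.

Lemma cform_wvec n k n' j : (cform (wvec n k) (wvec n' j) != 0) = (n == n') && (k +
  j == n)%N.
Proof.
have [<-|nn] := eqVneq n n'.
  by rewrite /wvec cform_iterQ -iterD -chain_wtop chain_wvec.
rewrite (cform_weight (wvec_weight n k) (wvec_weight n' j)) ?eqxx //.
by move/hwt_inj/eqP; rewrite (negbTE nn).
Qed.

Lemma wvec_neq0 n j : (j <= n)%N -> wvec n j <> 0.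
Proof.
move=> jn w0; have := cform_wvec n (n - j) n j.
by rewrite w0 cformr0 !eqxx subnK // eqxx.
Qed.

Lemma iterQ_wtop_eq0 n i : (n < i)%N -> iter i Q (wtop n) = 0.
Proof.
elim: n i => [|n IH] [|i] // ni.
  by rewrite iterSr sfQ_vac; elim: i {ni} => //= i ->; rewrite linear0.
by rewrite iterQ_true !IH ?linear0 ?scaler0 ?addr0 //=; lia.
Qed.

(** The term of [iterQ_true] in phi^+ contains too high a power of Q and vanishes; the remaining one
    gives nu = 2^n n!. *)
Lemma iterQ_wbot n : exists2 nu : C, nu != 0 & iter n Q (wtop n) = nu *: wbot n.
Proof.
elim: n => [|n [nu nu0 IH]]; first by exists 1; rewrite ?oner_eq0 ?scale1r.
exists ((2 * n.+1)%:R * nu); first by rewrite mulf_neq0 // pnatr_eq0.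
rewrite [wtop _]/= iterQ_true iterQ_wtop_eq0 // linear0 add0r IH linearZZ scalerA.
by [].
Qed.

(** Only the modes L(-m), m > 0, are built in; stability under the others is [vir_span_L], for w
    singular and homogeneous. *)
Inductive vir_span (w : V) : V -> Prop :=
  | VirGen : vir_span w w
  | Vir0 : vir_span w 0
  | VirLin a u v : vir_span w u -> vir_span w v -> vir_span w (a *: u + v)
  | VirL (m : nat) v : (0 < m)%N -> vir_span w v -> vir_span w (L (- m%:Z) v).

Lemma vir_span_subspace w : subspace (vir_span w).
Proof. by split; [exact: Vir0 | move=> *; exact: VirLin]. Qed.

Lemma vir_span_L w h (m : int) v : singular w -> weight h w -> vir_span w v ->
  vir_span w (L m v).
Proof.
move=> sw ww hv; have hS := vir_span_subspace w.
elim: hv m => {v} [||a u v _ IHu _ IHv|k v k0 hv IH] m.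
- have [m0|m0] := ltrP m 0.
    have -> : m = - (`|m|%N)%:Z by lia.
    by apply: VirL; [lia | exact: VirGen].
  move: m0; rewrite le_eqVlt => /orP[/eqP <-|m0].
    by rewrite ww; apply: subspaceZ => //; exact: VirGen.
  have -> : m = (`|m|%N)%:Z by lia.
  by rewrite sw; [exact: Vir0 | lia].
- by rewrite linear0; exact: Vir0.
- by rewrite linearP; exact: VirLin.
- rewrite sfLL; apply: subspaceD => //; last exact: subspaceZ.
  by apply: subspaceD => //; [exact: VirL | exact: subspaceZ].
Qed.

(** The images of the L(-m), m > 0, are orthogonal to singular vectors, which therefore see only the
    coefficient along w. *)
Lemma vir_span_decomp w v : vir_span w v ->
  exists c, forall u, singular u -> cform u (v - c *: w) = 0.
Proof.
elim=> {v} [||a u v _ [c IHu] _ [d IHv]|m v m0 _ _].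
- by exists 1 => u _; rewrite scale1r subrr cformr0.
- by exists 0 => u _; rewrite scale0r subrr cformr0.
- exists (a * c + d) => z sz; rewrite scalerDl opprD addrACA -scalerA -scalerBr.
  by rewrite cformDr cformZr IHu // IHv // mulr0 addr0.
- by exists 0 => u su; rewrite scale0r subr0 -cform_L su // cform0l.
Qed.

Definition piece (n j : nat) : V -> Prop := vir_span (wvec n j).

Lemma piece_L n j (m : int) v : piece n j v -> piece n j (L m v).
Proof. exact: vir_span_L (@wvec_singular n j) (@wvec_weight n j). Qed.

Lemma piece_subspace n j : subspace (piece n j).
Proof. exact: vir_span_subspace. Qed.

(** Moving the Virasoro modes of u over to v reduces u to w_{n,j}; [vir_span_decomp] then reduces v
    to a multiple of w_{n',k}. *)
Lemma piece_orth n j n' k u v : (k <= n')%N ->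
  piece n j u -> piece n' k v -> (n != n') || (j + k != n)%N -> cform u v = 0.
Proof.
move=> kn' hu hv ne.
have g0 : cform (wvec n j) (wvec n' k) = 0.
  by apply/eqP; rewrite -[_ == 0]negbK cform_wvec negb_and.
elim: hu v hv => {u} [||a u1 u2 _ IH1 _ IH2|m u m0 _ IH] v hv.
- have [c hc] := vir_span_decomp hv.
  have := hc _ (@wvec_singular n j); rewrite cformBr cformZr g0 mulr0 subr0.
  by [].
- by rewrite cform0l.
- by rewrite cformDl cformZl IH1 // IH2 // mulr0 addr0.
- by rewrite cform_L opprK IH //; exact: piece_L.
Qed.

Definition pieces_sum (v : V) : Prop := exists (N : nat) (f : nat -> nat -> V),
  (forall n j, (j <= n)%N -> piece n j (f n j)) /\
  v = \sum_(n < N) \sum_(j < n.+1) f n j.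

Lemma pieces_sum_widen N N' (f : nat -> nat -> V) : (N <= N')%N ->
  \sum_(n < N) \sum_(j < n.+1) f n j =
  \sum_(n < N') \sum_(j < n.+1) (if (n < N)%N then f n j else 0).
Proof.
move=> NN; rewrite (big_ord_widen _ (fun n => \sum_(j < n.+1) f n j) NN) big_mkcond.
by apply: eq_bigr => n _; case: ifP => // _; rewrite big1.
Qed.

Lemma pieces_sum_subspace : subspace pieces_sum.
Proof.
split=> [|a u v [N [f [hf ->]]] [N' [f' [hf' ->]]]].
  exists 0%N, (fun _ _ => 0); split; last by rewrite big_ord0.
  by move=> n j _; exact: Vir0.
rewrite (pieces_sum_widen f (leq_maxl N N')) (pieces_sum_widen f' (leq_maxr N N')).
exists (maxn N N'), (fun n j => a *: (if (n < N)%N then f n j else 0) + (if (n <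
  N')%N then f' n j else 0)).
split=> [n j jn|].
  by apply: VirLin; case: ifP => _; [exact: hf | exact: Vir0 | exact: hf' | exact:
    Vir0].
rewrite scaler_sumr -big_split; apply: eq_bigr => n _ /=.
by rewrite scaler_sumr -big_split.
Qed.

Lemma pieces_sum_L (m : int) v : pieces_sum v -> pieces_sum (L m v).
Proof.
move=> [N [f [hf ->]]]; exists N, (fun n j => L m (f n j)); split.
  by move=> n j jn; apply: piece_L; exact: hf.
by rewrite linear_sum; apply: eq_bigr => n _; rewrite linear_sum.
Qed.

Lemma pieces_sum_piece n j v : (j <= n)%N -> piece n j v -> pieces_sum v.
Proof.
move=> jn hv; exists n.+1, (fun a b => if (a == n) && (b == j) then v else 0).
split=> [a b _|].
  by case: ifP => [/andP[/eqP -> /eqP ->] //|_]; exact: Vir0.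
rewrite big_ord_recr /= eqxx big1 ?add0r; last first.
  by move=> a _; rewrite big1 // => b _; rewrite ltn_eqF.
have jn' : (j < n.+1)%N by [].
rewrite (bigD1 (Ordinal jn')) //= eqxx big1 ?addr0 // => b.
by rewrite -val_eqE /= => /negbTE ->.
Qed.

(** * Finite spanning sets of weight spaces, exhaustion, irreducibility *)

Inductive hom_span : V -> Prop :=
  | HomGen g x : weight g x -> hom_span x
  | HomLin a u v : hom_span u -> hom_span v -> hom_span (a *: u + v).

Lemma hom_ind (S : V -> Prop) : subspace S -> (forall g x, weight g x -> S x) ->
  forall x, S x.
Proof.
move=> hS Sw x.
suff : hom_span x.
  by elim=> {x} [g x /Sw //|a u v _ Su _ Sv]; case: hS => _; exact.
elim/(creation_ind (F := F)): x => [||e a v a0].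
- split=> [|a u v]; last exact: HomLin.
  by apply: (@HomGen 0%N); rewrite /weight linear0 scaler0.
- by apply: HomGen (weight_vac F).
- elim=> {v} [g x w|k u v _ Su _ Sv]; first by apply: HomGen;
  exact: weight_creation w.
  by rewrite linearP; exact: HomLin.
Qed.

Definition cop (w : seq (bool * nat)) : V :=
  foldr (fun l x => P l.1 (- l.2.+1%:Z) x) vac w.

Definition cwt (w : seq (bool * nat)) : nat := sumn [seq l.2.+1 | l <- w].

Lemma cop_weight w : weight (cwt w) (cop w).
Proof.
elim: w => [|l w IH]; first exact: weight_vac.
by rewrite /cwt /= addnC; exact: weight_creation.
Qed.

Fixpoint words_le (A : seq (bool * nat)) (k : nat) : seq (seq (bool * nat)) :=
  if k is k'.+1 then [::] :: [seq l :: w | l <- A, w <- words_le A k']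
  else [:: [::]].

Lemma mem_words_le A k w : (size w <= k)%N -> {subset w <= A} -> w \in words_le A k.
Proof.
elim: k w => [|k IH] [|l w] //= wk wA; rewrite inE //=.
apply: allpairs_f; first by apply: wA; rewrite inE eqxx.
by apply: IH => // x xw; apply: wA; rewrite inE xw orbT.
Qed.

(** A finite list of all creation words of weight g: they have at most g letters, and a letter (e,
    a) stands for the mode - (a + 1), so a < g. *)
Definition words_wt (g : nat) : seq (seq (bool * nat)) :=
  [seq w <- words_le [seq (e, a) | e <- [:: true;
    false], a <- iota 0 g] g | cwt w == g].

Lemma cwt_size w : (size w <= cwt w)%N.
Proof. by elim: w => //= l w IH; rewrite /cwt /=; rewrite /cwt in IH; lia. Qed.

Lemma cwt_mem w l : l \in w -> (l.2 < cwt w)%N.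
Proof.
elim: w => //= x w IH; rewrite inE => /orP[/eqP -> |/IH]; rewrite /cwt /=; lia.
Qed.

Lemma mem_words_wt w : w \in words_wt (cwt w).
Proof.
rewrite mem_filter eqxx; apply: mem_words_le; first exact: cwt_size.
move=> [e a] /cwt_mem ha; apply: (allpairs_f pair); last by rewrite mem_iota.
by case: e {ha}.
Qed.

Lemma cop_span x (S : V -> Prop) : subspace S -> (forall w, S (cop w)) -> S x.
Proof.
move=> hS Sw; suff [s ->] : exists s : seq (C * seq (bool * nat)),
  x = \sum_(p <- s) p.1 *: cop p.2.
  by apply: subspace_sum => // p _; exact: subspaceZ.
elim/(creation_ind (F := F)): x => [||e [//|a] v _ [s ->]].
- split=> [|a u v [s ->] [t ->]]; first by exists [::]; rewrite big_nil.
  exists ([seq (a * p.1, p.2) | p <- s] ++ t); rewrite big_cat big_map scaler_sumr.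
  by congr (_ + _); apply: eq_bigr => p _; rewrite scalerA.
- by exists [:: (1, [::])]; rewrite big_seq1 scale1r.
- exists [seq (p.1, (e, a) :: p.2) | p <- s]; rewrite big_map linear_sum.
  by apply: eq_bigr => p _; rewrite linearZZ.
Qed.

Lemma cform_words_nondeg g x : weight g x ->
  (forall w, w \in words_wt g -> cform x (cop w) = 0) -> x = 0.
Proof.
move=> wx hx; apply: (cform_nondeg (F := F)) => y.
apply: (@cop_span y (fun y => cform x y = 0)).
  split=> [|a u v u0 v0]; first by rewrite cformr0.
  by rewrite cformDr cformZr u0 v0 mulr0 addr0.
move=> w; have [gw|gw] := eqVneq g (cwt w).
  by apply: hx; rewrite gw mem_words_wt.
by apply: cform_weight wx (cop_weight w) _; exact/eqP.
Qed.

Lemma cform_weight_nondeg g x : weight g x ->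
  (forall y, weight g y -> cform x y = 0) -> x = 0.
Proof.
move=> wx hx; apply: (cform_words_nondeg wx) => w.
by rewrite mem_filter => /andP[/eqP gw _]; apply: hx; rewrite -gw; exact: cop_weight.
Qed.

(** In the least weight g where some x is missing, take u of weight g orthogonal to the sum but not
    to x. Since L(-m) maps the lower weights, already covered, into the sum, u is singular; by
    [singular_detect] it is not orthogonal to some w_{n,k}, which lies in the sum. *)
Lemma pieces_sumT x : pieces_sum x.
Proof.
have TS := pieces_sum_subspace.
apply: hom_ind => // {x} g; have [n] := ubnP g; elim: n g => // n IH g gn x wx.
apply: contrapT => Tx.
pose e (j : 'I_(size (words_wt g))) := cop (nth [::] (words_wt g) j).
(* The pairings with the spanning words are coordinates on weight g, injective by nondegeneracy;
   they carry the duality to row vectors. *)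
pose r y : 'rV[C]_(size (words_wt g)) := \row_j cform y (e j).
have we j : weight g (e j).
  have := mem_nth [::] (ltn_ord j); rewrite mem_filter => /andP[/eqP h _].
  by rewrite -h; exact: cop_weight.
have rP a y z : r (a *: y + z) = a *: r y + r z.
  by apply/rowP => j; rewrite !mxE cformDl cformZl.
pose U (u : 'rV[C]_(size (words_wt g))) := exists y, [/\ weight g y,
  pieces_sum y & u = r y].
have wS := weight_subspace F g.
have US : subspace U.
  split=> [|a u v [y [wy Ty ->]] [z [wz Tz ->]]].
    exists 0; split; [by case: wS | by case: TS |].
    by apply/rowP => j; rewrite !mxE cform0l.
  exists (a *: y + z); split; rewrite ?rP //; last by case: TS => _; exact.
  by case: wS => _; exact.
have Ux : ~ U (r x).
  move=> [y [wy Ty ry]]; apply: Tx; suff -> : x = y by [].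
  apply/subr0_eq/(@cform_words_nondeg g); first exact: subspaceB.
  move=> w /(nthP [::]) [i ig <-]; move/rowP/(_ (Ordinal ig)): ry.
  by rewrite !mxE /e /= cformBl => ->; rewrite subrr.
have [c [cU cx]] := separating_col US Ux.
(* Pairing with u is the separating functional. *)
pose u := \sum_j c j 0 *: e j.
have ru y : cform y u = (r y *m c) 0 0.
  rewrite /u cform_sumr mxE; apply: eq_bigr => j _.
  by rewrite cformZr mxE mulrC.
have yu y : weight g y -> pieces_sum y -> cform y u = 0.
  by move=> wy Ty; rewrite ru cU ?mxE //; exists y.
have wu : weight g u by apply: subspace_sum => // j _; exact: subspaceZ.
have u0 : u <> 0.
  move=> u0; apply: cx; apply/rowP => k; rewrite ord1 -ru u0 cformr0.
  by rewrite mxE.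
have su : singular u.
  move=> m m0; have [mg|gm] := leqP m g; last by apply: (weight_L_eq0 (F :=
    F) _ wu); lia.
  apply: (@cform_weight_nondeg (g - m)); first by apply: (weight_L (F := F) _ wu);
    lia.
  move=> z wz; rewrite cform_L cform_sym yu //.
    by apply: (weight_L (F := F) _ wz); lia.
  by apply: pieces_sum_L; apply: (IH (g - m)%N) => //; lia.
have [n' [k [kn gn' hk]]] := singular_detect su wu u0.
have gE : g = hwt n' by have := hwt_double n'; lia.
apply: hk; rewrite chain_wtop -cform_iterQ -/(wvec n' k) yu //.
  by rewrite gE; exact: wvec_weight.
exact: (pieces_sum_piece kn (VirGen _)).
Qed.

(** By [piece_orth], f n j meets only [piece n (n - j)]; there its pairing equals that of the whole
    sum, which is 0. *)
Lemma pieces_direct N (f : nat -> nat -> V) :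
  (forall n j, (j <= n)%N -> piece n j (f n j)) ->
  \sum_(n < N) \sum_(j < n.+1) f n j = 0 ->
  forall n j, (n < N)%N -> (j <= n)%N -> f n j = 0.
Proof.
move=> hf f0 n j nN jn; apply: (cform_nondeg (F := F)) => y.
have [N' [f' [hf' ->]]] := pieces_sumT y.
rewrite cform_sumr big1 // => a _; rewrite cform_sumr big1 // => b _.
have ba : (b <= a)%N by rewrite -ltnS.
have [E|ne] := boolP ((n != a) || (j + b != n)%N).
  exact: (piece_orth ba (hf _ _ jn) (hf' _ _ ba) E).
move: ne; rewrite negb_or !negbK => /andP[/eqP na /eqP jb].
have := congr1 (fun v => cform v (f' a b)) f0; rewrite cform0l => {f0} f0.
rewrite -[RHS]f0.
have cs I r (p : pred I) g z : cform (\sum_(i <- r | p i) g i) z = \sum_(i <- r | p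
  i) cform (g i) z.
  by rewrite cform_sym cform_sumr; apply: eq_bigr => i _; rewrite cform_sym.
rewrite cs (bigD1 (Ordinal nN)) //= [X in _ + X]big1 ?addr0; last first.
  move=> i; rewrite -val_eqE /= => ine; rewrite cs big1 // => k _.
  have ki : (k <= i)%N by rewrite -ltnS.
  apply: (piece_orth ba (hf _ _ ki) (hf' _ _ ba)).
  by apply/orP; left; rewrite -na.
have jn' : (j < n.+1)%N by [].
rewrite cs (bigD1 (Ordinal jn')) //= [X in _ + X]big1 ?addr0 // => k.
rewrite -val_eqE /= => kj.
have kn : (k <= n)%N by rewrite -ltnS.
apply: (piece_orth ba (hf _ _ kn) (hf' _ _ ba)).
by apply/orP; right; lia.
Qed.

(** A vector y of least weight in N is singular, and it is detected by some w_{n',k}, so its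
    coefficient c along w_{n,j} is nonzero. Then y - c w_{n,j} is singular and orthogonal to all
    singular vectors, hence 0. *)
Lemma piece_irreducible n j (N : V -> Prop) : (j <= n)%N -> subspace N ->
  (forall v, N v -> piece n j v) -> (forall (m : int) v, N v -> N (L m v)) ->
  (forall v, N v -> v = 0) \/ (forall v, piece n j v -> N v).
Proof.
move=> jn NS ND NL.
have [h|h] := pselect (forall v, N v -> v = 0); first by left.
right; suff Nw : N (wvec n j).
  move=> v; elim=> {v} // [|a u v _ Nu _ Nv|m v _ _ Nv]; first by case: NS.
    by case: NS => _; exact.
  exact: NL.
have [x [Nx x0]] : exists x, N x /\ x <> 0.
  apply: contrapT => hn; apply: h => v Nv; apply: contrapT => v0; apply: hn.
  by exists v.
have [g0 [y0 [Ny0 y00 wy0]]] := homogeneous_in NS (NL 0) Nx x0.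
pose p g := `[< exists y, [/\ N y, y <> 0 & weight g y] >].
have ex : exists g, p g by exists g0; apply/asboolP; exists y0.
case: (ex_minnP ex) => g /asboolP[y [Ny yn0 wy]] gmin.
have sy : singular y.
  move=> m m0; have [mg|gm] := leqP m g; last by apply: (weight_L_eq0 (F :=
    F) _ wy); lia.
  apply: contrapT => Ly.
  have /gmin : p (g - m)%N.
    apply/asboolP; exists (L m y); split=> //; first exact: NL.
    by apply: (weight_L (F := F) _ wy); lia.
  lia.
have [c hc] := vir_span_decomp (ND _ Ny).
have detect z g' : singular z -> weight g' z -> z <> 0 ->
    exists n' k, g' = hwt n' /\ cform (wvec n' k) z <> 0.
  move=> sz wz z0; have [n' [k [_ gn hk]]] := singular_detect sz wz z0.
  exists n', k; split; first by have := hwt_double n'; lia.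
  by rewrite /wvec cform_iterQ -chain_wtop.
have [n' [k [gn hk]]] := detect _ _ sy wy yn0.
have := hc _ (@wvec_singular n' k); rewrite cformBr cformZr => /subr0_eq hk'.
have : c * cform (wvec n' k) (wvec n j) != 0 by rewrite -hk'; exact/eqP.
rewrite mulf_eq0 negb_or cform_wvec => /and3P[c0 /eqP nn _].
apply: (subspaceZ_inv NS c0); suff <- : y = c *: wvec n j by [].
apply/subr0_eq; apply: contrapT => z0.
have [] := detect (y - c *: wvec n j) g _ _ z0.
- by move=> m m0; rewrite linearB linearZZ sy // (@wvec_singular n j) // scaler0
  subr0.
- apply: subspaceB; [exact: weight_subspace | by [] |].
  by apply: subspaceZ; [exact: weight_subspace | rewrite gn nn; exact: wvec_weight].
- by move=> n'' [k'' [_]]; apply; apply: hc; exact: wvec_singular.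
Qed.

Lemma piece_LVir n j : (j <= n)%N ->
  is_LVir (fun m => L m) (piece n j) (- 2%:R) ((n ^ 2 + n)%:R / 2%:R : C).
Proof.
move=> jn.
have hw : (n ^ 2 + n)%:R / 2%:R = (hwt n)%:R :> C.
  apply: (mulIf (x := 2%:R)); first by rewrite pnatr_eq0.
  rewrite divfK ?pnatr_eq0 // -natrM; congr (_%:R); have := hwt_double n; lia.
split.
- split; [exact: piece_subspace | by move=> m a u v; rewrite linearP | by move=> *;
  exact: piece_L|].
  by move=> m k v _; rewrite sfLL [L k (L m v) + _]addrC addrAC addrK.
- exists (wvec n j); split.
  + exact: VirGen.
  + split; [exact: wvec_neq0 | by exists (hwt n)%:R; exact: wvec_weight |].
    move=> m m1; have -> : m = (`|m|%N)%:Z by lia.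
    by apply: wvec_singular; lia.
  + by rewrite hw; exact: wvec_weight.
  + move=> N [NS ND NL] Nw u; elim=> {u} // [|a u v _ Nu _ Nv|m v _ _ Nv].
    * by case: NS.
    * by case: NS => _; exact.
    * exact: NL.
- by move=> N [NS ND NL]; exact: piece_irreducible.
Qed.

Lemma pieces_decomposition : internal_direct_sum (fun _ : V => True) piece.
Proof.
split.
- by move=> n j jn; split=> //; exact: piece_subspace.
- by move=> v _; exact: pieces_sumT.
- by move=> N f; exact: pieces_direct.
Qed.

End SingularVectors.

(** * Vertex superalgebras *)

Section VertexAlgebra.
Context {C : numFieldType} {V : vertexSuperalgebra C}.
Implicit Types (a b c u v : V).

HB.instance Definition _ a n :=
  GRing.isLinear.Build C V V _ (nprod a n) (nprod_linear_r a n).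

Lemma nprodDr a n u v : nprod a n (u + v) = nprod a n u + nprod a n v.
Proof. exact: linearD. Qed.
Lemma nprodBr a n u v : nprod a n (u - v) = nprod a n u - nprod a n v.
Proof. exact: linearB. Qed.
Lemma nprodNr a n u : nprod a n (- u) = - nprod a n u.
Proof. exact: linearN. Qed.
Lemma nprodZr a n k u : nprod a n (k *: u) = k *: nprod a n u.
Proof. exact: linearZ. Qed.
Lemma nprodr0 a n : nprod a n 0 = 0.
Proof. exact: linear0. Qed.
Lemma nprodDl a b n u : nprod (a + b) n u = nprod a n u + nprod b n u.
Proof. by rewrite -[a]scale1r nprod_linear_l !scale1r. Qed.
Lemma nprod0l n u : nprod 0 n u = 0.
Proof. by apply: (addrI (nprod 0 n u)); rewrite -nprodDl !addr0. Qed.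
Lemma nprodZl k a n u : nprod (k *: a) n u = k *: nprod a n u.
Proof. by rewrite -[k *: a]addr0 nprod_linear_l nprod0l addr0. Qed.
Lemma nprodNl a n u : nprod (- a) n u = - nprod a n u.
Proof. by rewrite -scaleN1r nprodZl scaleN1r. Qed.

(** * Consequences of the Borcherds identity *)

Lemma gbin0 m : gbin C m 0 = 1.
Proof. by rewrite /gbin big_ord0 fact0 divr1. Qed.

Lemma gbin1 m : gbin C m 1 = m%:~R.
Proof. by rewrite /gbin big_ord1 subr0 divr1. Qed.

Lemma gbin_0l j : gbin C 0 j.+1 = 0.
Proof. by rewrite /gbin big_ord_recl /= subrr !mul0r. Qed.

(** At m + 1 this is (m^3 - m) / 6, the source of the central term. *)
Lemma gbin3 m : gbin C m 3 = ((m - 1) ^+ 3 - (m - 1))%:~R / 6%:R.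
Proof.
rewrite /gbin !big_ord_recl big_ord0 /= mulr1 -!rmorphM; congr (_%:~R / _).
by rewrite /bump /=; ring.
Qed.

Lemma gbinN2 j : (-1) ^+ j * gbin C (-2) j = j.+1%:R.
Proof.
rewrite /gbin mulrA; apply/eqP; rewrite -(inj_eq (mulIf (x := (j`!)%:R) _));
  last first.
  by rewrite pnatr_eq0 -lt0n fact_gt0.
rewrite divfK ?pnatr_eq0 -?lt0n ?fact_gt0 // -natrM -factS; apply/eqP.
elim: j => [|j IH]; first by rewrite big_ord0 mulr1.
rewrite big_ord_recr /= exprS mulN1r mulNr mulrA IH -mulrN.
have -> : - (-2 - j%:Z)%:~R = j.+2%:R :> C.
  by rewrite -rmorphN /= (_ : - (-2 - j%:Z) = j.+2%:Z) //; lia.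
by rewrite [in RHS]factS natrM mulrC.
Qed.

Lemma iterate_formula (p q : bool) a b c (n k : int) :
  va_par p a -> va_par q b -> exists N0 : nat, forall N : nat, (N0 <= N)%N ->
  nprod (nprod a n b) k c = \sum_(j < N) ((-1) ^+ j * gbin C n j) *:
     (nprod a (n - j%:Z) (nprod b (k + j%:Z) c)
      - ((-1) ^+ (p && q) * (-1) ^ n) *: nprod b (n + k - j%:Z) (nprod a j%:Z c)).
Proof.
move=> pa qb; have [N0 H] := borcherds c 0 n k pa qb.
exists N0.+1 => N NN; have := H N (ltnW NN).
case: N NN => // N NN; rewrite [in LHS]big_ord_recl big1 ?addr0; last first.
  by move=> i _; rewrite lift0 gbin_0l scale0r.
rewrite gbin0 scale1r add0r => ->.
by apply: eq_bigr => j _; rewrite !add0r.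
Qed.

Lemma commutator_formula (p q : bool) a b c (m k : int) :
  va_par p a -> va_par q b -> exists N0 : nat, forall N : nat, (N0 <= N)%N ->
  nprod a m (nprod b k c) - (-1) ^+ (p && q) *: nprod b k (nprod a m c)
  = \sum_(j < N) gbin C m j *: nprod (nprod a j%:Z b) (m + k - j%:Z) c.
Proof.
move=> pa qb; have [N0 H] := borcherds c m 0 k pa qb.
exists N0.+1 => N NN; have := H N (ltnW NN).
case: N NN => // N NN; rewrite [in RHS]big_ord_recl [X in _ = _ + X]big1 ?addr0;
  last first.
  by move=> i _; rewrite lift0 gbin_0l mulr0 scale0r.
rewrite gbin0 expr0 mulr1 scale1r add0r expr0z mulr1 => <-.
by apply: eq_bigr => j _; rewrite add0r.
Qed.

Lemma sum_ord_if (N : nat) (i : nat) (f : nat -> V) : (i < N)%N ->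
  \sum_(j < N) (if (j : nat) == i then f j else 0) = f i.
Proof. by move=> iN; rewrite -big_mkcond (big_pred1 (Ordinal iN)). Qed.

(** With b = vac at most one term of the iterate formula survives: j = - k - 1 in the first product
    for k < 0, j = k - 1 in the second for k > 0. *)
Lemma nprod_vaD p a (k : int) c : va_par p a ->
  nprod (vaD a) k c = - k%:~R *: nprod a (k - 1) c.
Proof.
move=> pa; have [N0 H] := iterate_formula c (-2) k pa (vac_even V).
pose N := maxn N0 (`|k|%N).+2; rewrite /vaD (H N) ?leq_maxl //.
have kN : (`|k| < N)%N by rewrite /N leq_max; apply/orP; right; lia.
under eq_bigr do rewrite gbinN2 !nprod_vacl andbF expr0 mul1r.
have -> : (-1 : C) ^ (-2) = 1 by rewrite -exprnN -signr_odd /= expr0 invr1.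
have [k0|k0] := ltrP k 0.
  rewrite -[RHS](@sum_ord_if N `|(k + 1)%R|%N (fun j =>
    - k%:~R *: nprod a (k - 1) c)); last by lia.
  apply: eq_bigr => j _.
  have -> : (-2 + k - j%:Z == -1) = false by lia.
  have -> : (k + j%:Z == -1) = ((j : nat) == `|(k + 1)%R|%N) by lia.
  rewrite scale1r subr0; case: eqP => [jk|_]; last by rewrite nprodr0 scaler0.
  congr (_ *: nprod _ _ _); last by lia.
  have -> : k = - j.+1%:Z by lia.
  by rewrite rmorphN opprK.
have [k1|k1] := eqVneq k 0.
  rewrite big1 ?k1 ?oppr0 ?scale0r // => j _.
  have -> : (-2 + 0 - j%:Z == -1) = false by lia.
  have -> : (0 + j%:Z == -1) = false by lia.
  by rewrite nprodr0 scaler0 subr0 scaler0.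
rewrite -[RHS](@sum_ord_if N `|(k - 1)%R|%N (fun j =>
  - k%:~R *: nprod a (k - 1) c)); last by lia.
apply: eq_bigr => j _.
have -> : (-2 + k - j%:Z == -1) = ((j : nat) == `|(k - 1)%R|%N) by lia.
have -> : (k + j%:Z == -1) = false by lia.
rewrite scale1r nprodr0 sub0r; case: eqP => [jk|_]; last by rewrite oppr0 scaler0.
rewrite scalerN scaleNr; congr (- (_ *: nprod _ _ _)); last by lia.
by have -> : k = j.+1%:Z by lia.
Qed.

Lemma vaDD u v : vaD (u + v) = vaD u + vaD v.
Proof. exact: nprodDl. Qed.

Lemma vaD_linear : linear (@vaD C V).
Proof. by move=> k u v; rewrite /vaD nprod_linear_l. Qed.

Lemma vaD_vac : vaD (vac V) = 0.
Proof. by rewrite /vaD nprod_vacl. Qed.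

(** Expand (a_(n) b)_(-2) vac: only j = 0 and j = 1 contribute. The identity is stated for elements
    of definite parity, hence the splitting of c. *)
Lemma vaD_nprod p a (n : int) c : va_par p a ->
  vaD (nprod a n c) = nprod a n (vaD c) - n%:~R *: nprod a (n - 1) c.
Proof.
move=> pa.
have hom q b : va_par q b -> vaD (nprod a n b) = nprod a n (vaD b) - n%:~R *: nprod
  a (n - 1) b.
  move=> qb; have [N0 H] := iterate_formula (vac V) n (-2) pa qb.
  rewrite {1}/vaD (H N0.+2); last by rewrite -addn2 leq_addr.
  rewrite !big_ord_recl /= big1 ?addr0; last first.
    move=> i _; rewrite [nprod a _ (vac V)]nprod_vacr // [nprod b (-2 + _)
      _]nprod_vacr; last by rewrite /bump /=; lia.
    by rewrite !nprodr0 scaler0 subr0 scaler0.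
  rewrite ![nprod a _ (vac V)]nprod_vacr // !nprodr0 !scaler0 !subr0 gbin0 gbin1
    expr0 mulr1 scale1r.
  by rewrite expr1 mulN1r scaleNr nprod_creation.
have [u [w [pu pw ->]]] := va_par_sum c.
rewrite vaDD !nprodDr vaDD (hom _ _ pu) (hom _ _ pw) scalerDr opprD.
by rewrite addrACA.
Qed.

Definition modes_stable (M : V -> Prop) u := forall n v, M v -> M (nprod u n v).

(** Modes of a product are combinations of composed modes, by a formula for elements of definite
    parity. The induction therefore carries an even and an odd part of u, each with modes preserving
    M. *)
Lemma modes_stable_gen (M S : V -> Prop) : subspace M ->
  (forall u, S u -> exists p, va_par p u) -> (forall u, S u -> modes_stable M u) ->
  va_stable (va_gen S) M.
Proof.
move=> MS Sp SM.
have M0 : modes_stable M 0 by move=> n v _; rewrite nprod0l; case: MS.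
have Mlin k u v : modes_stable M u -> modes_stable M v -> modes_stable M (k *: u + v).
  by move=> hu hv n x Mx; rewrite nprod_linear_l; case: MS => _; apply; auto.
have Mprod p q u v n : va_par p u -> va_par q v ->
    modes_stable M u -> modes_stable M v -> modes_stable M (nprod u n v).
  move=> pu qv hu hv k x Mx; have [N0 /(_ N0 (leqnn _)) ->] :=
    iterate_formula x n k pu qv.
  apply: subspace_sum => // j _; apply: subspaceZ => //; apply: subspaceB => //; auto.
  by apply: subspaceZ; auto.
have par0 p : va_par p (0 : V) by case: (va_par_subspace V p).
have parL p k (u v : V) : va_par p u -> va_par p v -> va_par p (k *: u + v).
  by case: (va_par_subspace V p) => _; exact.
move=> u n v Su Mv.
suff [u0 [u1 [-> _ _ h0 h1]]] : exists u0 u1, [/\ u = u0 + u1, va_par false u0,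
  va_par true u1,
    modes_stable M u0 & modes_stable M u1].
  by rewrite nprodDl; apply: subspaceD; auto.
elim: Su => {u v Mv} [u Su|||k u v _ [u0 [u1 [-> pu0 pu1 h0 h1]]] _ [v0 [v1 [-> pv0
  pv1 k0 k1]]]
    |u m v _ [u0 [u1 [-> pu0 pu1 h0 h1]]] _ [v0 [v1 [-> pv0 pv1 k0 k1]]]].
- have [[] pu] := Sp _ Su.
    by exists 0, u; rewrite add0r; split; auto.
  by exists u, 0; rewrite addr0; split; auto.
- exists (vac V), 0; rewrite addr0; split; auto; first exact: vac_even.
  by move=> m v Mv; rewrite nprod_vacl; case: ifP => // _; case: MS.
- by exists 0, 0; rewrite addr0; split; auto.
- exists (k *: u0 + v0), (k *: u1 + v1); split; auto.
  by rewrite scalerDr addrACA.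
- exists (1 *: nprod u0 m v0 + nprod u1 m v1), (1 *: nprod u0 m v1 + nprod u1 m
  v0); split.
  + by rewrite nprodDl !nprodDr !scale1r [nprod u1 m v0 + _]addrC addrACA.
  + by apply: parL; [exact: (nprod_par m pu0 pv0) | exact: (nprod_par m pu1 pv1)].
  + by apply: parL; [exact: (nprod_par m pu0 pv1) | exact: (nprod_par m pu1 pv0)].
  + by apply: Mlin; [exact: Mprod pu0 pv0 _ _ | exact: Mprod pu1 pv1 _ _].
  + by apply: Mlin; [exact: Mprod pu0 pv1 _ _ | exact: Mprod pu1 pv0 _ _].
Qed.

Lemma va_gen_ind (M S : V -> Prop) : subspace M -> M (vac V) ->
  (forall u, S u -> exists p, va_par p u) -> (forall u, S u -> modes_stable M u) ->
  forall u, va_gen S u -> M u.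
Proof.
move=> MS M1 Sp SM u Su; rewrite -(nprod_creation u).
exact: (modes_stable_gen MS Sp SM).
Qed.

End VertexAlgebra.

Section Kernel.
Context {C : numFieldType} {U W : lmodType C} (f : {linear U -> W}).

Definition ker_pred : {pred U} := [pred v | f v == 0].

Lemma ker_pred_closed : submod_closed ker_pred.
Proof.
split=> [|a u v]; rewrite !inE ?linear0 // => /eqP fu /eqP fv.
by rewrite linearP fu fv scaler0 addr0.
Qed.

HB.instance Definition _ := GRing.isSubmodClosed.Build C U ker_pred ker_pred_closed.

(** Fbar is a predicate on F, whereas a [symplecticFermion] lives on a module; the kernel is
    therefore made a type. *)
Record kernel := Kernel { kerval :> U; _ : kerval \in ker_pred }.

HB.instance Definition _ := [isSub for kerval].
HB.instance Definition _ := [Choice of kernel by <:].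
HB.instance Definition _ := [SubChoice_isSubLmodule of kernel by <:].

Lemma kerP (v : kernel) : f (kerval v) = 0.
Proof. by apply/eqP; case: v. Qed.

Lemma mem_ker v : f v = 0 -> v \in ker_pred.
Proof. by move=> /eqP. Qed.

Definition ker_of v (fv : f v = 0) : kernel := Kernel (mem_ker fv).

Lemma kerval_linear : linear kerval.
Proof. by []. Qed.

Definition restr (g : U -> U) (gf : forall v, f v = 0 -> f (g v) = 0) (v : kernel)
  : kernel :=
  ker_of (gf _ (kerP v)).

Lemma restr_linear g gf : linear g -> linear (@restr g gf).
Proof. by move=> gl a u v; apply: val_inj => /=; rewrite gl. Qed.

Definition lin_restr g gf (gl : linear g) : {linear kernel -> kernel} :=
  HB.pack (@restr g gf) (GRing.isLinear.Build C kernel kernel _ (@restr g gf)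
    (@restr_linear g gf gl)).

End Kernel.

(** * The Clifford vertex superalgebra *)

Section Transport.
Context {C : numFieldType} {U V : lmodType C} (iota : {linear U -> V}).
Hypothesis iota_inj : injective iota.

Definition image_of (M : U -> Prop) (v : V) : Prop := exists2 u, M u & iota u = v.

Lemma image_subspace M : subspace M -> subspace (image_of M).
Proof.
move=> [M0 ML]; split=> [|a u v [x Mx <-] [y My <-]]; first by exists 0;
  rewrite ?linear0.
by exists (a *: x + y); [exact: ML | rewrite linearP].
Qed.

Lemma is_LVir_image (LU : int -> U -> U) (LV : int -> V -> V) M c h :
  (forall m, linear (LV m)) -> (forall m u, iota (LU m u) = LV m (iota u)) ->
  is_LVir LU M c h -> is_LVir LV (image_of M) c h.
Proof.
move=> Llin LI [[MS _ ML Mrel] [w [Mw [w0 [h' wh'] wm] wh wgen]] Msimple].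
have sub N : virasoro_submodule LV (image_of M) N ->
    virasoro_submodule LU M (fun u => N (iota u)).
  move=> [[N0 NL] NM NS]; split.
  - by split=> [|a u v]; rewrite ?linear0 ?linearP //; exact: NL.
  - by move=> u /NM [x Mx /iota_inj <-].
  - by move=> m u /(NS m); rewrite LI.
split.
- split=> //; first exact: image_subspace.
    by move=> m v [u Mu <-]; exists (LU m u); [exact: ML | rewrite LI].
  move=> m n v [u Mu <-]; rewrite -!LI -linearB Mrel // linearD !linearZZ.
  by [].
- exists (iota w); split.
  + by exists w.
  + split; first by move=> e; apply: w0; apply: iota_inj; rewrite e linear0.
      by exists h'; rewrite -LI wh' linearZZ.
    by move=> m m1; rewrite -LI wm // linear0.
  + by rewrite -LI wh linearZZ.
  + by move=> N /sub NU Nw v [u Mu <-]; exact: (wgen _ NU).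
- move=> N NV; have [_ NM _] := NV; have [z|f] := Msimple _ (sub _ NV).
    left=> v Nv; have [u _ uv] := NM _ Nv.
  by rewrite -uv (z u) ?linear0 // uv.
  by right=> v [u Mu <-]; exact: f.
Qed.

End Transport.

Section Clifford.
Context {C : numClosedFieldType} {F : vertexSuperalgebra C}.
Context (Phi : 'I_2 -> F) (hF : clifford_generated Phi).
Local Notation a1 := (Phi ord0).
Local Notation a2 := (Phi ord_max).
Local Notation s := (sqrtC (2%:R : C)).
Local Notation w := (omega Phi).
Local Notation L := (Lop Phi).
Local Notation Q := (Qop Phi).

Lemma sqrtC2_sq : s * s = 2%:R.
Proof. by rewrite -expr2 sqrtCK. Qed.

Lemma sqrtC2_neq0 : s != 0.
Proof. by rewrite sqrtC_eq0 pnatr_eq0. Qed.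

Lemma sqr_i : 'i * 'i = -1 :> C.
Proof. by rewrite -expr2 sqrCi. Qed.

(** Both phi^+ and phi^- have modes of this shape; commutation with L(k), D and Q becomes a
    computation on the pair (al, be). *)
Definition cl (al be : C) (n : int) (v : F) : F :=
  al *: nprod a1 n v + be *: nprod a2 n v.

Lemma cl_linear al be n : linear (cl al be n).
Proof.
move=> k u v; rewrite /cl !nprodDr !nprodZr !scalerDr !scalerA.
by rewrite ![k * _]mulrC addrACA.
Qed.

Lemma clZ k al be n v : k *: cl al be n v = cl (k * al) (k * be) n v.
Proof. by rewrite /cl scalerDr !scalerA. Qed.

Lemma clD al be al' be' n v : cl al be n v + cl al' be' n v = cl (al + al') (be +
  be') n v.
Proof. by rewrite /cl !scalerDl addrACA. Qed.

Lemma clN al be n v : - cl al be n v = cl (- al) (- be) n v.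
Proof. by rewrite -scaleN1r clZ !mulN1r. Qed.

Lemma cl_vac al be n : 0 <= n -> cl al be n (vac F) = 0.
Proof. by move=> n0; rewrite /cl !nprod_vacr // !scaler0 addr0. Qed.

Lemma cliff i j n m v : nprod (Phi i) n (nprod (Phi j) m v) =
  (if (i == j) && (n + m + 1 == 0) then v else 0) - nprod (Phi j) m (nprod (Phi i)
    n v).
Proof. by case: hF => _ _ /(_ i j n m v) <- _; rewrite /fmode addrK. Qed.

Lemma clDr al be n u v : cl al be n (u + v) = cl al be n u + cl al be n v.
Proof. by rewrite -[u]scale1r cl_linear !scale1r. Qed.

Lemma clr0 al be n : cl al be n 0 = 0.
Proof. by apply: (addrI (cl al be n 0)); rewrite -clDr !addr0. Qed.

Lemma clZr al be n k v : cl al be n (k *: v) = k *: cl al be n v.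
Proof. by rewrite -[k *: v]addr0 cl_linear clr0 addr0. Qed.

Lemma clBr al be n u v : cl al be n (u - v) = cl al be n u - cl al be n v.
Proof. by rewrite -scaleN1r addrC cl_linear scaleN1r addrC. Qed.

Lemma cl0 n v : cl 0 0 n v = 0.
Proof. by rewrite /cl !scale0r addr0. Qed.

Lemma a1_cl al be n m v : nprod a1 n (cl al be m v) =
  (if n + m + 1 == 0 then al else 0) *: v - cl al be m (nprod a1 n v).
Proof.
rewrite {1}/cl nprodDr !nprodZr (cliff ord0 ord0 n) (cliff ord0 ord_max n) /=.
rewrite sub0r scalerBr scalerN -addrA -opprD.
by case: eqP; rewrite ?scaler0 ?scale0r.
Qed.

Lemma a2_cl al be n m v : nprod a2 n (cl al be m v) =
  (if n + m + 1 == 0 then be else 0) *: v - cl al be m (nprod a2 n v).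
Proof.
rewrite {1}/cl nprodDr !nprodZr (cliff ord_max ord0 n) (cliff ord_max ord_max n) /=.
rewrite sub0r scalerBr scalerN addrCA -opprD.
by case: eqP; rewrite ?scaler0 ?scale0r.
Qed.

Lemma cl_anti al be n al' be' m v :
  cl al be n (cl al' be' m v) =
  (if n + m + 1 == 0 then al * al' + be * be' else 0) *: v - cl al' be' m (cl al be
    n v).
Proof.
rewrite {1}/cl a1_cl a2_cl !scalerBr addrACA -opprD; congr (_ - _); last first.
  by rewrite [cl al be n v]/cl clDr !clZr.
by case: eqP => _; rewrite !scalerA -scalerDl // !mulr0 addr0.
Qed.

Lemma Phi_odd i : va_par true (Phi i).
Proof. by case: hF. Qed.

Lemma omegaE : w = 'i *: nprod a2 (-2) a1 + nprod a1 (-2) a1.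
Proof. by rewrite /omega /fmode2 /fmode1 /fmode !nprod_creation. Qed.

Lemma omega_even : va_par false w.
Proof.
rewrite omegaE; case: (va_par_subspace F false) => _; apply.
  exact: (nprod_par _ (Phi_odd _) (Phi_odd _)).
exact: (nprod_par _ (Phi_odd _) (Phi_odd _)).
Qed.

Lemma Phi_mode i j (n : int) : 0 <= n -> nprod (Phi i) n (Phi j) =
  if (i == j) && (n == 0) then vac F else 0.
Proof.
move=> n0; rewrite -[Phi j]nprod_creation cliff [nprod (Phi i) n (vac F)]nprod_vacr
  //.
by rewrite nprodr0 subr0; congr (if _ && _ then _ else _); lia.
Qed.

Lemma a1_0_omega : nprod a1 0 w = - ('i *: vaD a2 + vaD a1).
Proof.
rewrite omegaE nprodDr nprodZr (cliff ord0 ord_max 0) (cliff ord0 ord0 0) /= !sub0r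
  !Phi_mode //= scalerN -opprD.
by [].
Qed.

Lemma a1_pos_omega (n : int) : 0 < n -> nprod a1 n w = if n == 1 then a1 else 0.
Proof.
move=> n0; rewrite omegaE nprodDr nprodZr (cliff ord0 ord_max n) (cliff ord0 ord0
  n) /= !Phi_mode ?ltW //=.
have -> : (n == 0) = false by lia.
rewrite !nprodr0 !subr0 scaler0 add0r; congr (if _ then _ else _); lia.
Qed.

Lemma a2_omega (n : int) : 0 <= n -> nprod a2 n w = if n == 1 then 'i *: a1 else 0.
Proof.
move=> n0; rewrite omegaE nprodDr nprodZr (cliff ord_max ord_max n) (cliff ord_max
  ord0 n) /= !Phi_mode //= !nprodr0.
rewrite !subr0 addr0.
have -> : (n + -2 + 1 == 0) = (n == 1) by lia.
by case: eqP; rewrite ?scaler0.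
Qed.

(** The commutator formula for an operator product with poles of order at most two. *)
Lemma comm_two (p q : bool) (a b : F) (m k : int) c : va_par p a -> va_par q b ->
  (forall j : nat, (1 < j)%N -> nprod a j%:Z b = 0) ->
  nprod a m (nprod b k c) - (-1) ^+ (p && q) *: nprod b k (nprod a m c)
  = nprod (nprod a 0 b) (m + k) c + m%:~R *: nprod (nprod a 1 b) (m + k - 1) c.
Proof.
move=> pa pb hj; have [N0 H] := commutator_formula c m k pa pb.
rewrite (H N0.+2); last by rewrite -addn2 leq_addr.
rewrite !big_ord_recl big1 ?addr0; last by move=> i _; rewrite hj // nprod0l scaler0.
by rewrite gbin0 scale1r -[gbin C m (lift ord0 ord0)]/(gbin C m 1) gbin1.
Qed.

Lemma a1_L (n k : int) v : nprod a1 n (L k v) - L k (nprod a1 n v) =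
  cl ((2 * n + k + 1)%:~R) ('i * (n + k + 1)%:~R) (n + k) v.
Proof.
have := @comm_two true false a1 w n (k + 1) v (Phi_odd _) omega_even.
rewrite andbF expr0 scale1r => ->; last first.
  by move=> j j1; rewrite a1_pos_omega //; [rewrite gt_eqF // | ]; lia.
rewrite a1_0_omega a1_pos_omega // nprodNl nprodDl nprodZl !(nprod_vaD _ _ (Phi_odd
  _)).
have -> : n + (k + 1) - 1 = n + k by lia.
rewrite eqxx scalerA opprD -!scaleNr -addrA -scalerDl addrC /cl.
congr (_ *: _ + _ *: _); ring.
Qed.

Lemma a2_L (n k : int) v : nprod a2 n (L k v) - L k (nprod a2 n v) =
  cl ('i * n%:~R) 0 (n + k) v.
Proof.
have := @comm_two true false a2 w n (k + 1) v (Phi_odd _) omega_even.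
rewrite andbF expr0 scale1r => ->; last first.
  by move=> j j1; rewrite a2_omega //; rewrite gt_eqF //; lia.
rewrite !a2_omega //= nprod0l add0r nprodZl scalerA /cl scale0r addr0 mulrC.
by congr (_ *: nprod _ _ _); lia.
Qed.

Lemma L_linear k : linear (L k).
Proof. by move=> a u v; rewrite /Lop /vir_mode nprodDr nprodZr. Qed.

Lemma cl_L al be n k v : L k (cl al be n v) = cl al be n (L k v) -
  cl ((2 * n + k + 1)%:~R * al + 'i * n%:~R * be) ('i * (n + k + 1)%:~R * al) (n +
    k) v.
Proof.
apply/eqP; rewrite eq_sym subr_eq addrC -subr_eq; apply/eqP.
have -> : L k (cl al be n v) = al *: L k (nprod a1 n v) + be *: L k (nprod a2 n v).
  by rewrite /cl /Lop /vir_mode nprodDr !nprodZr.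
rewrite {1}/cl opprD addrACA -!scalerBr a1_L a2_L !clZ clD mulr0 addr0.
congr (cl _ _ _ _); ring.
Qed.

Lemma cl_D al be n v : vaD (cl al be n v) = cl al be n (vaD v) - cl (n%:~R * al)
  (n%:~R * be) (n - 1) v.
Proof.
have -> : vaD (cl al be n v) = al *: vaD (nprod a1 n v) + be *: vaD (nprod a2 n v).
  by rewrite /vaD /cl nprodDl !nprodZl.
rewrite !(vaD_nprod _ _ (Phi_odd _)) !scalerBr addrACA -opprD; congr (_ - _).
by rewrite /cl !scalerA ![_ * n%:~R]mulrC.
Qed.

Lemma Q_linear : linear Q.
Proof.
move=> k u v; rewrite /Qop L_linear vaD_linear scalerBr opprD addrACA.
by [].
Qed.

(** The commutator with Q is always a multiple of a mode of Phi_1 + i Phi_2, and it is 0 for that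
    field itself, as 1 + i i = 0. *)
Lemma cl_Q al be n v : Q (cl al be n v) = cl al be n (Q v) -
  cl (n%:~R * (al + 'i * be)) ('i * n%:~R * (al + 'i * be)) (n - 1) v.
Proof.
rewrite /Qop cl_L cl_D clBr opprB [cl _ _ (n - 1) v - _]addrC addrACA; congr (_ + _).
by rewrite !clN clD; congr (cl _ _ _ _); ring: sqr_i.
Qed.

Lemma Q_vac : Q (vac F) = 0.
Proof. by rewrite /Qop /Lop /vir_mode nprod_vacr // vaD_vac subr0. Qed.

Definition phi (e : bool) (n : int) : F -> F :=
  if e then phi_plus Phi n else phi_minus Phi n.

Lemma phiE e n v : phi e n v =
  if e then cl (- s * n%:~R) (- s * ('i * (n + 1)%:~R)) n v
  else cl (- (n%:~R / s)) (- (n%:~R / s) * 'i) (n - 1) v.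
Proof. by case: e; rewrite /= /phi_plus /phi_minus /cl scalerDr !scalerA. Qed.

Lemma phi_linear e n : linear (phi e n).
Proof. by move=> a u v; rewrite !phiE; case: e; rewrite cl_linear. Qed.

Lemma phi_anti e m e' n v : phi e m (phi e' n v) =
  pairing_coef C e m e' n *: v - phi e' n (phi e m v).
Proof.
rewrite !phiE; case: e e' => [] [] /=; rewrite cl_anti; congr (_ *: _ - _);
  rewrite ?pairing_same ?pairing_true ?pairing_false.
- case: eqP => // mn; have -> : n = - m - 1 by lia.
  rewrite -[RHS](mulr0 (s * s)); ring: sqr_i.
- have -> : (m + (n - 1) + 1 == 0) = (m + n == 0) by lia.
  case: eqP => // mn; have -> : n = - m by lia.
  field: sqr_i; exact: sqrtC2_neq0.
- have -> : (m - 1 + n + 1 == 0) = (m + n == 0) by lia.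
  case: eqP => // mn; have -> : n = - m by lia.
  field: sqr_i; exact: sqrtC2_neq0.
- case: eqP => // mn.
  field: sqr_i; exact: sqrtC2_neq0.
Qed.

(** For this [omega] both phi^+ and phi^- are primary of weight 1, whereas L(m) mixes the modes of
    Phi_1 and Phi_2. *)
Lemma phi_L e m n v : L m (phi e n v) = phi e n (L m v) - n%:~R *: phi e (m + n) v.
Proof.
rewrite !phiE; case: e; rewrite cl_L clZ; congr (_ - _).
- have -> : n + m = m + n by rewrite addrC.
  by congr (cl _ _ _ _); ring: sqr_i.
- have -> : n - 1 + m = m + n - 1 by lia.
  by congr (cl _ _ _ _); field: sqr_i; exact: sqrtC2_neq0.
Qed.

Lemma phi_Q e n v : Q (phi e n v) =
  phi e n (Q v) + (if e then 2%:R *: phi false n v else 0).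
Proof.
rewrite !phiE; case: e; rewrite cl_Q.
  rewrite clN clZ; congr (_ + cl _ _ _ _); field: sqr_i sqrtC2_sq; exact: sqrtC2_neq0.
have -> : - (n%:~R / s) + 'i * (- (n%:~R / s) * 'i) = 0 by ring: sqr_i.
by rewrite !mulr0 cl0 subr0 addr0.
Qed.

Lemma phi_vac e n : 0 <= n -> phi e n (vac F) = 0.
Proof.
move=> n0; rewrite phiE; case: e; first exact: cl_vac.
have [->|n1] := eqVneq n 0; first by rewrite mul0r oppr0 mul0r cl0.
by rewrite cl_vac //; lia.
Qed.

Lemma L_vac m : -1 <= m -> L m (vac F) = 0.
Proof. by move=> m1; rewrite /Lop /vir_mode nprod_vacr //; lia. Qed.

Lemma omega_phi : w = phi false (-1) (phi true (-1) (vac F)).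
Proof.
rewrite omegaE !phiE /cl !addrN !mulr0 scale0r addr0 nprod_creation !nprodZr.
have s0 := sqrtC2_neq0.
rewrite !scalerA.
have -> : - ((-1)%:~R / s) * (- s * (-1)%:~R) = 1 :> C by field.
have -> : - ((-1)%:~R / s) * 'i * (- s * (-1)%:~R) = 'i :> C by field.
by rewrite scale1r addrC.
Qed.

Lemma L_omega m : -1 <= m -> L m w =
  phi false (-1) (phi true (m - 1) (vac F)) + phi false (m - 1) (phi true (-1) (vac
    F)).
Proof.
move=> m1; rewrite [X in L m X]omega_phi !phi_L L_vac //.
have p0 e n : phi e n 0 = 0.
  by rewrite phiE; case: e; rewrite clr0.
by rewrite p0 sub0r rmorphN scaleNr opprK scale1r scaleNr opprK scale1r.
Qed.

Lemma Q_omega : Q w = 0.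
Proof.
rewrite omega_phi !phi_Q Q_vac addr0.
have p0 e n : phi e n 0 = 0 by rewrite phiE; case: e; rewrite clr0.
rewrite p0 add0r.
have pZ e n k v : phi e n (k *: v) = k *: phi e n v.
  by rewrite phiE [in RHS]phiE; case: e; rewrite clZr.
rewrite pZ.
have /eqP := phi_anti false (-1) false (-1) (vac F).
rewrite pairing_same scale0r sub0r -subr_eq0 opprK -mulr2n -scaler_nat => /eqP ->.
by [].
Qed.

Lemma phi0 e n : phi e n 0 = 0.
Proof. by rewrite phiE; case: e; rewrite clr0. Qed.

(** [omega] is phi^-(-1) phi^+(-1) applied to the vacuum, so [phi_L] computes these products; the
    third one is c / 2 = -1. *)
Lemma omega_omega (j : nat) : nprod w j%:Z w =
  match j with 0 => vaD w | 1 => 2%:R *: w | 3 => - vac F | _ => 0 end.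
Proof.
have -> : nprod w j%:Z w = L (j%:Z - 1) w by rewrite /Lop /vir_mode subrK.
case: j => [|[|j]].
- have -> : L (0%:Z - 1) w = Q w + vaD w by rewrite /Qop subrK.
  by rewrite Q_omega add0r.
- by rewrite L_omega // -omega_phi scaler_nat.
- rewrite L_omega; last by lia.
  rewrite phi_vac; last by lia.
  rewrite phi0 add0r phi_anti [phi false _ (vac F)]phi_vac; last by lia.
  rewrite phi0 subr0 pairing_false.
  case: j => [|[|j]].
  + by rewrite scale0r.
  + by rewrite scaleN1r.
  + have -> : (j.+4%:Z - 1 - 1 - 1 == 0) = false by lia.
    by rewrite scale0r.
Qed.

Lemma omega_modes (m k : int) v : nprod w m (nprod w k v) - nprod w k (nprod w m v) =
  (m - k)%:~R *: nprod w (m + k - 1) v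
  - gbin C m 3 *: (if m + k - 3 == -1 then v else 0).
Proof.
have [N0 H] := commutator_formula v m k omega_even omega_even.
have := H N0.+4; rewrite expr0 scale1r => ->; last by rewrite -addn4 leq_addr.
rewrite !big_ord_recl big1 ?addr0; last first.
  by move=> i _; rewrite omega_omega /= nprod0l scaler0.
rewrite !omega_omega /= -[gbin C m (lift ord0 ord0)]/(gbin C m 1) gbin0 gbin1 scale1r.
rewrite /bump /= (nprod_vaD _ _ omega_even) nprodZl scalerA nprod0l scaler0 add0r.
rewrite nprodNl nprod_vacl scalerN addrA -scalerDl; congr (_ *: _ - _); ring.

Qed.

Lemma L_L (m k : int) v : L m (L k v) = L k (L m v) + (m - k)%:~R *: L (m + k) v
  + central_coef (- 2%:R) m k *: v.
Proof.
apply/eqP; rewrite -addrA addrC -subr_eq; apply/eqP.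
rewrite /Lop /vir_mode omega_modes.
have -> : m + 1 - (k + 1) = m - k by lia.
have -> : m + 1 + (k + 1) - 1 = m + k + 1 by lia.
congr (_ + _); rewrite /central_coef.
have -> : (m + 1 + (k + 1) - 3 == -1) = (m + k == 0) by lia.
case: eqP => _; last by rewrite scaler0 oppr0 scale0r.
rewrite gbin3 addrK -scaleNr; congr (_ *: _).
rewrite !rmorphB !rmorphXn /=.
by field.
Qed.

(** * Restriction to the kernel of Phi_2(1/2) *)

Lemma L_phi0 (m : int) v : nprod a2 0 v = 0 -> nprod a2 0 (L m v) = 0.
Proof.
move=> v0; have /eqP := a2_L 0 m v; rewrite v0 subr_eq mulr0 cl0 add0r => /eqP ->.
by rewrite /Lop /vir_mode nprodr0.
Qed.

Lemma vaD_phi0 v : nprod a2 0 v = 0 -> nprod a2 0 (vaD v) = 0.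
Proof.
move=> v0; have := vaD_nprod 0 v (Phi_odd ord_max).
by rewrite v0 scale0r subr0 => <-; rewrite /vaD nprod0l.
Qed.

Lemma Q_phi0 v : nprod a2 0 v = 0 -> nprod a2 0 (Q v) = 0.
Proof. by move=> v0; rewrite nprodBr L_phi0 ?vaD_phi0 ?subr0. Qed.

(** Phi_2(1/2) contracts only with Phi_2(-1/2), which could enter phi^+(-1) and phi^-(0); its
    coefficients there contain the factors n + 1 and n and vanish. *)
Lemma phi_phi0 e n v : nprod a2 0 v = 0 -> nprod a2 0 (phi e n v) = 0.
Proof.
move=> v0; rewrite phiE; case: e; rewrite a2_cl v0 clr0 subr0.
  case: eqP => [n1|_]; last by rewrite scale0r.
  have -> : n = -1 by lia.
  by rewrite addNr !mulr0 scale0r.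
case: eqP => [n1|_]; last by rewrite scale0r.
have -> : n = 0 by lia.
by rewrite mul0r oppr0 mul0r scale0r.
Qed.

Local Notation a20 := (nprod a2 0 : {linear F -> F}).

Definition Fker := kernel a20.

Definition kP e n : {linear Fker -> Fker} :=
  lin_restr (f := a20) (@phi_phi0 e n) (phi_linear e n).
Definition kL m : {linear Fker -> Fker} :=
  lin_restr (f := a20) (@L_phi0 m) (L_linear m).
Definition kQ : {linear Fker -> Fker} :=
  lin_restr (f := a20) Q_phi0 Q_linear.

Lemma vac_phi0 : nprod a2 0 (vac F) = 0.
Proof. exact: nprod_vacr. Qed.

Definition kvac : Fker := ker_of (f := a20) vac_phi0.

Lemma clifford_ind (M : F -> Prop) : subspace M -> M (vac F) ->
  (forall i n v, M v -> M (nprod (Phi i) n v)) -> forall v, M v.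
Proof.
move=> MS M1 MP v; case: hF => _ odd _ /(_ v) gv.
apply: (va_gen_ind MS M1 _ _ gv); first by move=> u [i ->]; exists true.
by move=> u [i ->] n x; exact: MP.
Qed.

Lemma a1_phi n v : nprod a1 n v = s^-1 *: phi true n v - s *: phi false (n + 1) v.
Proof.
have s0 := sqrtC2_neq0.
rewrite !phiE addrK !clZ clN clD.
have -> : s^-1 * (- s * n%:~R) + - (s * - ((n + 1)%:~R / s)) = 1 :> C by field.
have -> : s^-1 * (- s * ('i * (n + 1)%:~R)) + - (s * (- ((n + 1)%:~R / s) * 'i)) =
  0 :> C by field.
by rewrite /cl scale1r scale0r addr0.
Qed.

(** Inverts the two-by-two system giving phi^+(n) and phi^-(n + 1); at n = -1 neither contains
    Phi_2(-1/2). *)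
Lemma a2_phi n v : n != -1 -> nprod a2 n v =
  ('i / s) *: phi true n v - ('i * n%:~R * s / (n + 1)%:~R) *: phi false (n + 1) v.
Proof.
move=> n1; have s0 := sqrtC2_neq0.
have n0 : (n + 1)%:~R != 0 :> C by rewrite intr_eq0; lia.
have n0' : n%:~R + 1 != 0 :> C by rewrite -[1]/(1%:~R) -rmorphD.
rewrite !phiE addrK !clZ clN clD.
have -> : 'i / s * (- s * n%:~R) + - ('i * n%:~R * s / (n + 1)%:~R * - ((n + 1)%:~R
  / s)) = 0 :> C.
  by field; rewrite s0 n0'.
have -> : 'i / s * (- s * ('i * (n + 1)%:~R)) + - ('i * n%:~R * s / (n + 1)%:~R *
  (- ((n + 1)%:~R / s) * 'i)) = 1 :> C.
  by field: sqr_i; rewrite s0 n0'.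
by rewrite /cl scale1r scale0r add0r.
Qed.

Lemma kernel_span (S : Fker -> Prop) : subspace S -> S kvac ->
  (forall e n v, S v -> S (kP e n v)) -> forall v, S v.
Proof.
move=> SS S1 SP v.
pose E (x : F) := exists2 u : Fker, S u & val u = x.
have ES : subspace E.
  case: SS => S0 SL; split=> [|a x y [u Su <-] [u' Su' <-]]; first by exists 0.
  by exists (a *: u + u'); first exact: SL.
have EP e n x : E x -> E (phi e n x).
  by move=> [u Su <-]; exists (kP e n u); first exact: SP.
have E0 x : E x -> nprod a2 0 x = 0 by move=> [u _ <-]; exact: kerP.
have Ea1 n x : E x -> E (nprod a1 n x).
  by move=> Ex; rewrite a1_phi; apply: subspaceB => //; apply: subspaceZ => //;
    exact: EP.
have Ea2 n x : n != -1 -> E x -> E (nprod a2 n x).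
  by move=> n1 Ex; rewrite a2_phi //; apply: subspaceB => //;
    apply: subspaceZ => //; exact: EP.
(* Phi_2(-1/2) is the only mode which does not come from the phi^e(n). *)
pose G (x : F) := exists y z, [/\ E y, E z & x = y + nprod a2 (-1) z].
have Gall x : G x.
  apply: clifford_ind => [|| i n {}x [y [z [Ey Ez ->]]]].
  - split=> [|a x1 x2 [y [z [Ey Ez ->]]] [y' [z' [Ey' Ez' ->]]]].
      by exists 0, 0; rewrite nprodr0 addr0; case: ES => E00 _; split.
    exists (a *: y + y'), (a *: z + z'); case: ES => _ EL; split; try exact: EL.
    by rewrite nprodDr nprodZr scalerDr addrACA.
  - exists (vac F), 0; rewrite nprodr0 addr0; split=> //; last by case: ES.
    by exists kvac.
  - have {i} [->|->] : i = ord0 \/ i = ord_max.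
      by case: i => -[|[|//]] i2; [left | right]; apply: val_inj.
    + exists (nprod a1 n y), (- nprod a1 n z); split;
      [exact: Ea1 | by apply: subspaceN; auto |].
      by rewrite nprodDr (cliff ord0 ord_max) /= sub0r nprodNr.
    + have [->|n1] := eqVneq n (-1).
        exists 0, y; split=> //; first by case: ES.
        rewrite add0r nprodDr; have /eqP := cliff ord_max ord_max (-1) (-1) z.
        rewrite /= sub0r -subr_eq0 opprK -mulr2n -scaler_nat scaler_eq0 pnatr_eq0
          => /eqP ->.
        by rewrite addr0.
      exists (nprod a2 n y + (if n == 0 then z else 0)), (- nprod a2 n z); split.
      * apply: subspaceD => //; first exact: Ea2.
        by case: ifP => // _; case: ES.
      * by apply: subspaceN => //; exact: Ea2.
      * rewrite nprodDr (cliff ord_max ord_max n) /= nprodNr addrA.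
        by have -> : (n + -1 + 1 == 0) = (n == 0) by lia.
have [y [z [Ey Ez vyz]]] := Gall (val v).
(* Phi_2(1/2) kills v, y and z, and sends Phi_2(-1/2) z to z. *)
have z0 : z = 0.
  have := kerP v; rewrite vyz /= nprodDr (E0 _ Ey) (cliff ord_max ord_max 0) /= (E0
    _ Ez).
  by rewrite nprodr0 subr0 add0r.
have [u Su uv] := Ey; suff -> : v = u by [].
by apply: val_inj; rewrite vyz z0 nprodr0 addr0 uv.
Qed.

Definition Fbar_fermions : symplecticFermion Fker.
Proof.
apply: (@SymplecticFermion _ _ kP kL kQ kvac).
- by apply/eqP => /(congr1 val) /= e; case: hF => + _ _ _; rewrite e.
- by move=> e m e' n v; apply: val_inj; exact: phi_anti.
- by move=> e n n0; apply: val_inj; exact: phi_vac.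
- by move=> m e n v; apply: val_inj; exact: phi_L.
- by move=> m m1; apply: val_inj; exact: L_vac.
- by apply: val_inj; exact: (etrans (nprod_creation w) omega_phi).
- by move=> m n v; apply: val_inj; exact: L_L.
- by move=> n v; apply: val_inj; exact: (phi_Q true).
- by move=> n v; apply: val_inj; apply: (etrans (phi_Q false _ _)); exact: addr0.
- by apply: val_inj; exact: Q_vac.
- exact: kernel_span.
Defined.

Local Notation S := Fbar_fermions.

HB.instance Definition _ := GRing.isLinear.Build C Fker F _ (@kerval _ _ _ a20)
  (@kerval_linear _ _ _ a20).

Definition kval : {linear Fker -> F} := @kerval _ _ _ a20.

Lemma kval_inj : injective kval.
Proof. exact: val_inj. Qed.

Lemma kval_Fbar v : Fbar Phi (kval v).
Proof. exact: kerP. Qed.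

Lemma Fbar_kval v : Fbar Phi v -> exists u, kval u = v.
Proof. by move=> v0; exists (ker_of (f := a20) v0). Qed.

Lemma kval_L m u : kval (sfL S m u) = L m (kval u).
Proof. by []. Qed.

Lemma descending_plus n : descending (phi_plus Phi) n = kval (wtop S n).
Proof. by elim: n => //= n ->. Qed.

Lemma descending_minus n : descending (phi_minus Phi) n = kval (wbot S n).
Proof. by elim: n => //= n ->. Qed.

Lemma w_vecE n j : w_vec Phi n j = kval (wvec S n j).
Proof. by rewrite /w_vec descending_plus; elim: j => //= j ->. Qed.

Definition Fpiece (n j : nat) : F -> Prop := image_of kval (piece S n j).

Lemma Fpiece_LVir n j : (j <= n)%N ->
  is_LVir L (Fpiece n j) (- 2%:R) ((n ^ 2 + n)%:R / 2%:R).
Proof.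
move=> jn; apply: (is_LVir_image kval_inj L_linear kval_L); exact: piece_LVir.
Qed.

Lemma Fpiece_stable n j : va_stable (va_gen (fun u => u = w)) (Fpiece n j).
Proof.
apply: modes_stable_gen.
- exact/image_subspace/piece_subspace.
- by move=> u ->; exists false; exact: omega_even.
- move=> u -> m v [x hx <-]; exists (sfL S (m - 1) x); first exact: piece_L.
  by rewrite kval_L /Lop /vir_mode subrK.
Qed.

Lemma Virasoro_va_vac v : va_gen (fun u => u = w) v <-> Fpiece 0 0 v.
Proof.
split=> [gv|[x hx <-]].
  apply: (va_gen_ind _ _ _ _ gv).
  - exact/image_subspace/piece_subspace.
  - by exists (sfvac S); first exact: VirGen.
  - by move=> u ->; exists false; exact: omega_even.
  - by move=> u -> m x hx; apply: Fpiece_stable => //; exact: VaGenIn.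
elim: hx => {v x} [||a u v _ IHu _ IHv|m u m0 _ IH].
- exact: VaGenVac.
- exact: VaGen0.
- by rewrite linearP; exact: VaGenLin.
- by rewrite kval_L; apply: VaGenProd => //; exact: VaGenIn.
Qed.

(** An ideal is in particular a Virasoro submodule of the irreducible module generated by the
    vacuum. *)
Lemma Virasoro_va_simple : is_simple_virasoro_va (va_gen (fun u => u = w)) w (- 2%:R).
Proof.
have gS : subspace (va_gen (fun u => u = w)).
  by split; [exact: VaGen0 | move=> *; exact: VaGenLin].
have [Vmod _ Vsimple] := Fpiece_LVir (leqnn 0).
split=> //.
- split=> //; first exact: L_linear.
  + by move=> n v gv; apply: VaGenProd => //; exact: VaGenIn.
  + by case: Vmod => _ _ _ h m n v /Virasoro_va_vac; exact: h.
- split; first by exists (vac F); [exact: VaGenVac | case: hF].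
  move=> I [IS IU Istab _].
  have VI : virasoro_submodule L (Fpiece 0 0) I.
    split=> //; first by move=> v /IU /Virasoro_va_vac.
    by move=> n v Iv; apply: Istab => //; exact: VaGenIn.
  case: (Vsimple _ VI) => h; [by left | right=> v /Virasoro_va_vac; exact: h].
Qed.

Lemma Fbar_decomposition : internal_direct_sum (Fbar Phi) Fpiece.
Proof.
have [_ hgen hdir] := pieces_decomposition S.
split.
- move=> n j jn; split; first exact/image_subspace/piece_subspace.
  by move=> v [u _ <-]; exact: kval_Fbar.
- move=> v /Fbar_kval [u <-]; have [N [f [hf ->]]] := hgen u I.
  exists N, (fun n j => kval (f n j)); split; first by move=> n j jn;
    exists (f n j); auto.
  by rewrite linear_sum; apply: eq_bigr => n _; rewrite linear_sum.
- move=> N f hf f0.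
  have /choice [g hg] : forall nj : nat * nat, exists u,
      (nj.2 <= nj.1)%N -> piece S nj.1 nj.2 u /\ kval u = f nj.1 nj.2.
    move=> [n j] /=; case: (boolP (j <= n)%N) => [jn|_]; last by exists 0.
    by have [u hu uf] := hf _ _ jn; exists u.
  move=> n j nN jn; have [_ <-] := hg (n, j) jn.
  rewrite (hdir N (fun n j => g (n, j))) ?linear0 //.
    by move=> n' j' jn'; case: (hg (n', j') jn').
  apply: kval_inj; rewrite linear0 -[RHS]f0 linear_sum.
  apply: eq_bigr => a _; rewrite linear_sum; apply: eq_bigr => b _.
  by have [_ ->] := hg (nat_of_ord a, nat_of_ord b) (ltn_ord b).
Qed.

End Clifford.

Theorem theorem3p5 (R : realType) (F : vertexSuperalgebra R[i])
    (Phi : 'I_2 -> F) (hF : clifford_generated Phi) :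
  [/\ (forall n j : nat, (1 < n)%N -> (j <= n)%N ->
         Fbar Phi (w_vec Phi n j) /\
         singular_vector (Lop Phi) (w_vec Phi n j)),
      (forall n : nat, (1 < n)%N ->
         exists nu : R[i], nu <> 0 /\
           iter n (Qop Phi) (descending (phi_plus Phi) n)
           = nu *: descending (phi_minus Phi) n)
    & exists LVir0 : F -> Prop,
        is_simple_virasoro_va LVir0 (omega Phi) (- 2%:R) /\
        exists M : nat -> nat -> F -> Prop,
          internal_direct_sum (Fbar Phi) M /\
          forall n j : nat, (j <= n)%N ->
            va_stable LVir0 (M n j) /\
            is_LVir (Lop Phi) (M n j) (- 2%:R) ((n ^ 2 + n)%:R / 2%:R)].
Proof.
split.
- move=> n j _ jn; rewrite (w_vecE hF); split; first exact: kval_Fbar.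
  split.
  + move=> e; apply: (wvec_neq0 (F := Fbar_fermions hF) jn); apply: kval_inj.
    by rewrite e linear0.
  + exists (hwt n)%:R; rewrite -kval_L (wvec_weight (Fbar_fermions hF) n j).
    by rewrite linearZZ.
  + move=> m m1; have -> : m = (`|m|%N)%:Z by lia.
    rewrite -kval_L (@wvec_singular _ _ (Fbar_fermions hF)) ?linear0 //; lia.
- move=> n _; have [nu nu0 e] := iterQ_wbot (Fbar_fermions hF) n.
  exists nu; split; first exact/eqP.
  rewrite (descending_minus hF) -linearZZ -e -[LHS]/(w_vec Phi n n).
  by rewrite (w_vecE hF).
- exists (va_gen (fun u => u = omega Phi)); split; first exact: Virasoro_va_simple.
  exists (Fpiece hF); split; first exact: Fbar_decomposition.
  by move=> n j jn; split; [exact: Fpiece_stable | exact: Fpiece_LVir].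
Qed.
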